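(* Let $p\in\{1,2,3,\dots\}\cup\{\infty\}$ and let $X$ be a Banach space with an unconditional basis which admits a Lipschitz, $C^{p}$-smooth bump function. Then the following hold. (A) Let $Y\subset X$ be a convex subset and let $f:Y\to\mathbb{R}$ be a uniformly continuous map. Then for each $\varepsilon>0$ there exists a Lipschitz, $C^{p}$-smooth function $K:X\to\mathbb{R}$ such that $|f(y)-K(y)|<\varepsilon$ for all $y\in Y$. (B) There is a constant $C_{0}>1$ depending only on $X$ (in particular, independent of $\varepsilon$, and also of $\eta$, $f$, $Y$ and $Z$ below) such that: (i) for every Banach space $Z$, every $\eta$-Lipschitz map $f:X\to Z$, and every $\varepsilon>0$, there exists a $C^{p}$-smooth map $K:X\to Z$ which is Lipschitz with constant no larger than $C_{0}\eta$ and satisfies $\|f(x)-K(x)\|<\varepsilon$ for all $x\in X$; (ii) for every subset $Y\subset X$ (not necessarily convex), every $\eta$-Lipschitz function $f:Y\to\mathbb{R}$, and every $\varepsilon>0$, there exists a $C^{p}$-smooth function $K:X\to\mathbb{R}$ which is Lipschitz with constant no larger than $C_{0}\eta$ and satisfies $|f(y)-K(y)|<\varepsilon$ for all $y\in Y$.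
   Context: Banach spaces are real. ''Unconditional basis'' means unconditional Schauder basis $\{e_j\}_{j=1}^\infty$. Smoothness is in the Fréchet sense: a map between Banach spaces is $C^p$-smooth if it is $p$ times continuously Fréchet differentiable (for all finite orders if $p=\infty$). A $C^{p}$-smooth bump function on $X$ is a $C^{p}$-smooth function $b:X\to\mathbb{R}$ whose support $\overline{\{x\in X: b(x)\neq 0\}}$ is bounded and non-empty. A map $f$ is $\eta$-Lipschitz (Lipschitz with constant $\eta$) if $\|f(x)-f(x')\|\le \eta\|x-x'\|$ for all $x,x'$ in its domain. *)

(* Defs.v *)
From HB Require Import structures.
From mathcomp Require Import all_boot all_order all_algebra.
From mathcomp Require Import all_classical all_reals all_analysis.

Set Implicit Arguments.
Unset Strict Implicit.
Unset Printing Implicit Defensive.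

Import Order.TTheory GRing.Theory Num.Theory.
Import numFieldNormedType.Exports.

Local Open Scope classical_set_scope.
Local Open Scope ring_scope.

(** The normed space L(X, Z) of continuous linear maps, with the operator norm. *)
Section ContinuousLinearMaps.
Variables (R : realType) (X Z : normedModType R).

Definition clin_pred : {pred X -> Z} :=
  fun g => `[< linear g /\ continuous g >].

Lemma clin_submod_closed : submod_closed clin_pred.
Proof.
split.
  rewrite unfold_in; apply/asboolP; split.
    by move=> a x y; exact: (esym (etrans (addr0 _) (scaler0 _ _))).
  by move=> x; exact: cvg_cst.
move=> a f g; rewrite !unfold_in => /asboolP[lf cf] /asboolP[lg cg].
apply/asboolP; split.
  move=> b x y; rewrite !fctE lf lg !scalerDr !scalerA (mulrC b a).
  by rewrite -!addrA; congr (_ + _); rewrite addrCA.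
move=> x; apply: cvgD; last exact: cg.
by apply: cvgZ; [exact: cvg_cst|exact: cf].
Qed.

HB.instance Definition _ :=
  GRing.isSubmodClosed.Build R (X -> Z) clin_pred clin_submod_closed.

Record clin := Clin { clin_fun :> X -> Z ; _ : clin_fun \in clin_pred }.

HB.instance Definition _ := [isSub for clin_fun].
HB.instance Definition _ := [Choice of clin by <:].
HB.instance Definition _ := [SubChoice_isSubLmodule of clin by <:].

Lemma clin_linear (g : clin) : linear g.
Proof. by case: g => g /= /asboolP[]. Qed.

Lemma clin_continuous (g : clin) : continuous g.
Proof. by case: g => g /= /asboolP[]. Qed.

Definition clin_opnorm (g : clin) : R :=
  sup [set `|g x| | x in [set x | `|x| <= 1]].

HB.instance Definition _ (g : clin) :=
  GRing.isLinear.Build R X Z *:%R (clin_fun g) (@clin_linear g).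

Lemma clin_has_sup (g : clin) :
  has_sup [set `|g x| | x in [set x | `|x| <= 1]].
Proof.
split; first by exists `|g 0|, 0 => //=; rewrite normr0 ler01.
have /linear_bounded_continuous/bounded_funP/(_ 1)[M gM] :=
  @clin_continuous g.
by exists M => _ [x /= x1 <-]; exact: gM.
Qed.

Lemma clin_opnormP (g : clin) (x : X) : `|g x| <= clin_opnorm g * `|x|.
Proof.
have [->|x0] := eqVneq x 0; first by rewrite linear0 !normr0 mulr0.
have nx : 0 < `|x| by rewrite normr_gt0.
rewrite -ler_pdivrMr// mulrC.
have -> : `|x|^-1 * `|g x| = `|g (`|x|^-1 *: x)|.
  by rewrite linearZ/= normrZ gtr0_norm ?invr_gt0.
apply: ub_le_sup; first by case: (clin_has_sup g).
by exists (`|x|^-1 *: x) => //=; rewrite normfZV.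
Qed.

Lemma clin_opnorm_le (g : clin) (M : R) :
  (forall x, `|x| <= 1 -> `|g x| <= M) -> clin_opnorm g <= M.
Proof.
by move=> gM; apply: ge_sup => [|_ [x x1 <-]];
  [case: (clin_has_sup g)|exact: gM].
Qed.

Lemma clin_opnorm_ub (g : clin) x : `|x| <= 1 -> `|g x| <= clin_opnorm g.
Proof.
by move=> x1; apply: ub_le_sup; [case: (clin_has_sup g)|exists x].
Qed.

Lemma clin_opnorm_ge0 (g : clin) : 0 <= clin_opnorm g.
Proof.
apply: (le_trans (normr_ge0 (g 0))); apply: clin_opnorm_ub.
by rewrite normr0.
Qed.

Lemma clin_opnormD (f g : clin) :
  clin_opnorm (f + g) <= clin_opnorm f + clin_opnorm g.
Proof.
apply: clin_opnorm_le => x x1; apply: (le_trans (ler_normD (f x) (g x))).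
by apply: lerD; exact: clin_opnorm_ub.
Qed.

Let clin_opnormZ_le (a : R) (f : clin) :
  clin_opnorm (a *: f) <= `|a| * clin_opnorm f.
Proof.
apply: clin_opnorm_le => x x1.
have -> : (a *: f) x = a *: f x by [].
by rewrite normrZ ler_wpM2l// clin_opnorm_ub.
Qed.

Lemma clin_opnormZ (a : R) (f : clin) :
  clin_opnorm (a *: f) = `|a| * clin_opnorm f.
Proof.
apply/eqP; rewrite eq_le clin_opnormZ_le /=.
have [->|a0] := eqVneq a 0; first by rewrite normr0 mul0r clin_opnorm_ge0.
rewrite -ler_pdivlMl ?normr_gt0//.
rewrite -[X in clin_opnorm X <= _](scalerK a0) -normfV.
exact: clin_opnormZ_le.
Qed.

Lemma clin_opnorm0_eq0 (f : clin) : clin_opnorm f = 0 -> f = 0.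
Proof.
move=> f0; apply/val_inj/funext => x /=; apply/normr0_eq0/eqP.
by rewrite eq_le normr_ge0 andbT (le_trans (clin_opnormP f x))// f0 mul0r.
Qed.

HB.instance Definition _ :=
  Lmodule_isNormed.Build R clin clin_opnormD clin_opnormZ clin_opnorm0_eq0.

End ContinuousLinearMaps.

Section Smoothness.
Variable R : realType.

(** [insubd] only bundles ['d f x] as an element of [clin X Z]; its default value
    is never taken when [f] is differentiable at [x], see [frechetE]. *)
Definition frechet (X Z : normedModType R) (f : X -> Z) (x : X) : clin X Z :=
  insubd 0 ('d f x : X -> Z).

Lemma frechetE (X Z : normedModType R) (f : X -> Z) (x : X) :
  differentiable f x -> frechet f x = 'd f x :> (X -> Z).
Proof.
move=> dfx; rewrite /frechet [LHS]insubdK// unfold_in.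
by apply/asboolP; split; [exact: linearP|exact: diff_continuous].
Qed.

Fixpoint Ck (n : nat) (X Z : normedModType R) (f : X -> Z) : Prop :=
  if n is m.+1 then
    (forall x, differentiable f x) /\ Ck m (frechet f)
  else continuous f.

(** [Some n] stands for the order [n] and [None] for the order infinity. *)
Definition Cp_smooth (p : option nat) (X Z : normedModType R) (f : X -> Z) :
    Prop :=
  if p is Some n then Ck n f else forall n, Ck n f.

Definition is_bump (p : option nat) (X : normedModType R) (b : X -> R^o) :
    Prop :=
  let support := closure [set x | b x != 0] in
  [/\ Cp_smooth p b, bounded_set support & support !=set0].

Definition has_lipschitz_bump (p : option nat) (X : normedModType R) : Prop :=
  exists2 b : X -> R^o, is_bump p b & lipschitz b.

End Smoothness.

Section Bases.
Variables (R : realType) (X : completeNormedModType R).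

Definition schauder_basis (e : nat -> X) : Prop :=
  forall x : X, exists! a : nat -> R, series (fun n => a n *: e n) @ \oo --> x.

Definition unconditionally_convergent (u : nat -> X) : Prop :=
  forall s : nat -> nat, bijective s -> cvgn (series (u \o s)).

Definition unconditional_basis (e : nat -> X) : Prop :=
  schauder_basis e /\
  forall a : nat -> R, cvgn (series (fun n => a n *: e n)) ->
    unconditionally_convergent (fun n => a n *: e n).

End Bases.

(* Main.v *)
Require Import Defs.
From HB Require Import structures.
From mathcomp Require Import all_boot all_order all_algebra.
From mathcomp Require Import all_classical all_reals all_analysis.
From mathcomp Require Import ring lra.

Set Implicit Arguments.
Unset Strict Implicit.
Unset Printing Implicit Defensive.

Import Order.TTheory GRing.Theory Num.Theory.
Import numFieldNormedType.Exports.

Local Open Scope classical_set_scope.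
Local Open Scope ring_scope.

(** The approximation combines two constructions.

    Smoothness along finitely many directions is free. Averaging a Lipschitz map
    over the segments from [x] to [x + d] preserves all inequalities between
    translates, in particular the Lipschitz constant, and the derivative of the
    average along [d] is the increment of the map over the segment. Let the steps
    [d] run through a summable sequence that returns infinitely often to the
    direction of each basis vector. The limit [smoothing] has the Lipschitz constant
    of the given map and is uniformly close to it, and its partial derivatives
    along the basis are functions of the same kind ([smoothed_partial]). Hence it is
    infinitely smooth on the span of any finite set of basis vectors ([smoothed_Ck]).

    Infinitely many directions are reduced to finitely many by a map of the space
    that has, near each point, values in one of these spans: [retract] multiplies the
    n-th coordinate of [x] by one minus a smooth cutoff evaluated at the n-th tail of
    [x] divided by [r]. Multipliers act boundedly on an unconditional basis
    ([multipliers_bounded], by the category theorem), and the coordinates that are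
    cut belong to a tail of norm at most [r]. So the map is within a multiple of [r]
    of the identity, and the slope of the cutoff, which is of order [1 / r], is
    compensated by the size of the tail: the Lipschitz constant does not depend on
    [r] ([retract_Lip]). Composing the smoothing with the retraction gives
    [Lip_approximation].

    The constant obtained in this way depends on the Lipschitz constant of the
    cutoff, thus on the order of smoothness. This dependence is removed in
    [uniform_cutoff]. Any bump provides a cutoff of class [C^1]. On a small ball it
    differs from an affine function by a function with so small a Lipschitz constant
    that a smoother approximation of this difference still has a small Lipschitz
    constant, whatever the loss is; the approximations on the balls are glued by a
    partition of unity ([glue]). Every order of smoothness therefore has a cutoff
    whose Lipschitz constant is controlled by the one cutoff of class [C^1].

    Functions that are only given on a subset are extended by an infimal
    convolution. This covers Lipschitz functions, and also uniformly continuous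
    functions on convex sets, because these satisfy [|f x - f y| <= eps + A |x - y|]
    for a suitable [A]. *)

(** * Linear identities in modules *)

(** Syntax of linear expressions; the atoms are positions in a list of vectors. *)
Inductive lexpr (R : Type) : Type :=
  | LAtom of nat
  | LZero
  | LAdd of lexpr R & lexpr R
  | LOpp of lexpr R
  | LScale of R & lexpr R.
Arguments LAtom {R}.
Arguments LZero {R}.

Section LinearExpressions.
Variables (R : pzRingType) (V : lmodType R).

Fixpoint leval (env : seq V) (t : lexpr R) : V :=
  match t with
  | LAtom i => nth 0 env i
  | LZero => 0
  | LAdd s t => leval env s + leval env t
  | LOpp s => - leval env s
  | LScale a s => a *: leval env s
  end.

Fixpoint lcoef (i : nat) (t : lexpr R) : R :=
  match t with
  | LAtom j => if i == j then 1 else 0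
  | LZero => 0
  | LAdd s t => lcoef i s + lcoef i t
  | LOpp s => - lcoef i s
  | LScale a s => a * lcoef i s
  end.

Fixpoint lbound (n : nat) (t : lexpr R) : bool :=
  match t with
  | LAtom i => (i < n)%N
  | LZero => true
  | LAdd s t => lbound n s && lbound n t
  | LOpp s => lbound n s
  | LScale _ s => lbound n s
  end.

Fixpoint same_coefs (n : nat) (s t : lexpr R) : Prop :=
  if n is m.+1 then lcoef m s = lcoef m t /\ same_coefs m s t else True.

Lemma leval_coef env t : lbound (size env) t ->
  leval env t = \sum_(i < size env) lcoef i t *: env`_i.
Proof.
elim: t => [j|_|s IHs t IHt /andP[bs bt]|s IH bs|a s IH bs] /=.
- move=> jn; rewrite (bigD1 (Ordinal jn))//= eqxx scale1r big1 ?addr0// => i.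
  by rewrite -val_eqE/= => /negPf ->; rewrite scale0r.
- by rewrite big1// => i _; rewrite scale0r.
- by rewrite IHs// IHt// -big_split/=; apply: eq_bigr => i _; rewrite scalerDl.
- by rewrite IH// -sumrN; apply: eq_bigr => i _; rewrite scaleNr.
- by rewrite IH// scaler_sumr; apply: eq_bigr => i _; rewrite scalerA.
Qed.

Lemma leval_eq env s t :
  lbound (size env) s && lbound (size env) t -> same_coefs (size env) s t ->
  leval env s = leval env t.
Proof.
move=> /andP[bs bt] st; rewrite !leval_coef//; apply: eq_bigr => -[i/= ni] _.
congr (_ *: _); elim: (size env) ni st => [//|n IH]; rewrite ltnS leq_eqVlt.
by move=> /orP[/eqP -> []|/IH{}IH [_ /IH]].
Qed.

End LinearExpressions.

(* Atoms are compared up to unification, since the same vector may be elaborated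
   with different paths through the hierarchy of structures. *)
Ltac latom_index x env :=
  match env with
  | ?y :: _ => let _ := match goal with _ => constr_eq x y end in constr:(0%N)
  | ?y :: _ => let _ := match goal with _ => unify x y end in constr:(0%N)
  | _ :: ?env' => let i := latom_index x env' in constr:(i.+1)
  end.
Ltac latom_add x env :=
  match env with
  | _ => let _ := latom_index x env in env
  | _ => constr:(x :: env)
  end.
Ltac latoms t env :=
  lazymatch t with
  | ?a + ?b => let env' := latoms b env in latoms a env'
  | - ?a => latoms a env
  | ?c *: ?a => latoms a env
  | 0 => env
  | _ => latom_add t env
  end.
Ltac lreify R t env :=
  lazymatch t with
  | ?a + ?b =>
      let a' := lreify R a env in let b' := lreify R b env in
      constr:(@LAdd R a' b')
  | - ?a => let a' := lreify R a env in constr:(@LOpp R a')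
  | ?c *: ?a => let a' := lreify R a env in constr:(@LScale R c a')
  | 0 => constr:(@LZero R)
  | _ => let i := latom_index t env in constr:(@LAtom R i)
  end.
(* Two linear expressions agree in every module as soon as the coefficients of
   each atom agree, which is a question about scalars. *)
Ltac linear_coefs R :=
  lazymatch goal with
  | |- @eq ?V ?s ?t =>
      let env := latoms s constr:(@nil V) in
      let env := latoms t env in
      let s' := lreify R s env in
      let t' := lreify R t env in
      refine (@leval_eq _ _ env s' t' _ _); [exact isT|simpl; repeat split]
  end.
Ltac linear_identity R := linear_coefs (R : Type); try (by []); try field; try by [].

(** * Calculus *)

Section Frechet.
Variable R : realType.
Implicit Types X Y Z : normedModType R.

(** The derivative as a bounded linear map, with explicit bounds; all the rules of
    calculus are proved in this form. *)
Definition has_frechet X Z (f : X -> Z) (x : X) (L : clin X Z) :=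
  forall eps : R, 0 < eps -> exists2 del : R, 0 < del &
    forall h, `|h| < del -> `|f (x + h) - f x - L h| <= eps * `|h|.

Lemma has_frechetP X Z (f : X -> Z) x (L : clin X Z) :
  has_frechet f x L <-> differentiable f x /\ frechet f x = L.
Proof.
split.
- move=> fL.
  have E : f \o shift x = cst (f x) + (L : {linear X -> Z}) +o_ 0 id.
    apply/eqaddoP => e e0; have [d d0 fd] := fL e e0.
    apply/nbhs_norm0P; exists d => //= h hd.
    rewrite /= !fctE /= opprD addrA [h + x]addrC.
    exact: fd.
  have dL := @diff_unique _ _ _ f (L : {linear X -> Z}) x (@clin_continuous _ _ _ L) E.
  have dfx : differentiable f x.
    by apply/diff_locallyP; rewrite dL; split=> //; exact: clin_continuous.
  by split=> //; apply/val_inj; rewrite /= (frechetE dfx) dL.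
- move=> [dfx <-] e e0.
  have /diff_locallyP[_ /eqaddoP/(_ e e0)/nbhs_norm0P[d d0 fd]] := dfx.
  exists d => // h hd; rewrite (frechetE dfx); have := fd h hd.
  by rewrite /= !fctE /= opprD addrA [h + x]addrC.
Qed.

Lemma has_frechet_diff X Z (f : X -> Z) x L : has_frechet f x L -> differentiable f x.
Proof. by case/has_frechetP. Qed.

Lemma has_frechet_frechet X Z (f : X -> Z) x L :
  has_frechet f x L -> frechet f x = L.
Proof. by case/has_frechetP. Qed.

Lemma frechet_has X Z (f : X -> Z) x :
  differentiable f x -> has_frechet f x (frechet f x).
Proof. by move=> dfx; apply/has_frechetP. Qed.

Lemma Ck_step n X Z (f : X -> Z) (f' : X -> clin X Z) :
  (forall x, has_frechet f x (f' x)) -> Ck n f' -> Ck n.+1 f.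
Proof.
move=> ff' cf'; split; first by move=> x; exact: has_frechet_diff (ff' x).
suff -> : frechet f = f' by [].
by apply/funext => x; exact: has_frechet_frechet (ff' x).
Qed.

Lemma Ck_pred n X Z (f : X -> Z) : Ck n.+1 f -> Ck n f.
Proof.
elim: n X Z f => [|n IH] X Z f [df cf].
  by move=> x; exact: differentiable_continuous.
by split=> //; exact: IH.
Qed.

Lemma Ck_continuous n X Z (f : X -> Z) : Ck n f -> continuous f.
Proof. by elim: n => [//|n IH] /Ck_pred. Qed.

Lemma Ck_le m n X Z (f : X -> Z) : (m <= n)%N -> Ck n f -> Ck m f.
Proof.
by move=> /subnK <-; elim: (n - m)%N => [//|k IH]; rewrite addSn => /Ck_pred.
Qed.

(** The derivative at a point only depends on the germ of the function, so the
    local representatives may be differentiated in place of the function. *)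
Lemma Ck_local n X Z (f : X -> Z) :
  (forall x : X, exists2 g : X -> Z, Ck n g & \forall y \near x, f y = g y) -> Ck n f.
Proof.
elim: n X Z f => [|n IH] X Z f fg.
  move=> x; have [g cg fgx] := fg x.
  rewrite /prop_for /continuous_at (nbhs_singleton fgx).
  by apply: cvg_trans (cg x); apply: near_eq_cvg; apply: filterS fgx => y ->.
have H (x : X) : exists2 g : X -> Z, Ck n.+1 g & \forall y \near x, has_frechet f y (frechet g y).
  have [g cg fgx] := fg x; exists g => //.
  apply: filterS (near_join fgx) => y fgy e e0; have [dg _] := cg.
  have [d d0 gd] := frechet_has (dg y) e0.
  have /nbhs_norm0P[d' d'0 fd'] : \forall h \near 0, f (y + h) = g (y + h).
    by move/nbhs0P : fgy; apply: filterS => h; rewrite addrC.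
  exists (Num.min d d'); first by rewrite lt_min d0.
  move=> h; rewrite lt_min => /andP[hd hd'].
  by rewrite fd'// (nbhs_singleton fgy); exact: gd.
have Hx x : has_frechet f x (frechet f x).
  have [g _ /nbhs_singleton h] := H x.
  by rewrite (has_frechet_frechet h).
apply: Ck_step Hx _; apply: IH => x; have [g [_ cg] gx] := H x.
by exists (frechet g) => //; apply: filterS gx => y; exact: has_frechet_frechet.
Qed.

Lemma Ck_cst n X Z (c : Z) : Ck n (fun _ : X => c).
Proof.
elim: n X Z c => [|n IH] X Z c; first by move=> x; exact: cvg_cst.
apply: Ck_step (fun _ => 0) _ (IH _ _ 0) => x e e0; exists 1 => // h _.
by rewrite subrr sub0r normrN normr0 mulr_ge0// ltW.
Qed.

Lemma mkclin_subproof X Z (f : X -> Z) : linear f ->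
  (exists M, forall x, `|f x| <= M * `|x|) -> f \in @clin_pred R X Z.
Proof.
move=> lf [M fM]; apply/asboolP; split=> //.
pose F : {linear X -> Z} :=
  HB.pack_for {linear X -> Z} f (GRing.isLinear.Build R X Z *:%R f lf).
suff : continuous F by [].
apply: bounded_linear_continuous; apply/bounded_funP => r.
exists (`|M| * r) => x xr; apply: (le_trans (fM x)).
by rewrite (le_trans (ler_wpM2r _ (ler_norm M)))// ler_wpM2l.
Qed.

Definition mkclin X Z (f : X -> Z) (lf : linear f)
    (bf : exists M, forall x, `|f x| <= M * `|x|) : clin X Z :=
  Clin (mkclin_subproof lf bf).

Lemma clinD X Z (f g : clin X Z) x : (f + g) x = f x + g x. Proof. by []. Qed.
Lemma clinZ X Z (a : R) (f : clin X Z) x : (a *: f) x = a *: f x. Proof. by []. Qed.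
Lemma clin_sum X Z (n : nat) (f : nat -> clin X Z) x :
  (\sum_(i < n) f i) x = \sum_(i < n) f i x.
Proof. by elim: n => [|n IH]; rewrite ?big_ord0// !big_ord_recr clinD IH. Qed.

Lemma clin_norm_le X Z (f : clin X Z) (M : R) : 0 <= M ->
  (forall x, `|f x| <= M * `|x|) -> `|f| <= M.
Proof.
move=> M0 fM; apply: clin_opnorm_le => x x1; apply: (le_trans (fM x)).
by rewrite ler_piMr.
Qed.

Lemma clin_normP X Z (f : clin X Z) x : `|f x| <= `|f| * `|x|.
Proof. exact: clin_opnormP. Qed.

Lemma has_frechet_clin X Z (L : clin X Z) x : has_frechet L x L.
Proof.
move=> e e0; exists 1 => // h _.
have -> : L (x + h) - L x - L h = 0 by rewrite linearD/=; linear_identity R.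
by rewrite normr0 mulr_ge0// ltW.
Qed.

Lemma Ck_clin n X Z (L : clin X Z) : Ck n L.
Proof.
case: n => [|n]; first exact: clin_continuous.
exact: Ck_step (has_frechet_clin L) (Ck_cst n X L).
Qed.

Lemma has_frechetD X Z (f g : X -> Z) x A B :
  has_frechet f x A -> has_frechet g x B ->
  has_frechet (fun y => f y + g y) x (A + B).
Proof.
move=> fA gB e e0; have e20 : 0 < e / 2 by rewrite divr_gt0.
have [d d0 fd] := fA _ e20; have [d' d'0 gd] := gB _ e20.
exists (Num.min d d'); first by rewrite lt_min d0.
move=> h; rewrite lt_min => /andP[hd hd'].
rewrite clinD.
have -> : f (x + h) + g (x + h) - (f x + g x) - (A h + B h) =
  (f (x + h) - f x - A h) + (g (x + h) - g x - B h).
  by linear_identity R.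
rewrite (splitr e) mulrDl; apply: le_trans (ler_normD _ _) _.
by apply: lerD; [exact: fd|exact: gd].
Qed.

Lemma CkD n X Z (f g : X -> Z) : Ck n f -> Ck n g -> Ck n (fun x => f x + g x).
Proof.
elim: n X Z f g => [|n IH] X Z f g.
  by move=> cf cg x; apply: cvgD; [exact: cf|exact: cg].
move=> [df cf] [dg cg].
by apply: Ck_step (IH _ _ _ _ cf cg) => x; apply: has_frechetD; exact: frechet_has.
Qed.

Lemma Ck_sum n X Z N (f : nat -> X -> Z) : (forall i, (i < N)%N -> Ck n (f i)) ->
  Ck n (fun x => \sum_(i < N) f i x).
Proof.
elim: N => [|N IH] cf.
  rewrite (_ : (fun x => _) = fun=> 0); first exact: Ck_cst.
  by apply/funext => x; rewrite big_ord0.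
rewrite (_ : (fun x => _) = fun x => \sum_(i < N) f i x + f N x).
  by apply: CkD; [apply: IH => i iN; apply: cf; rewrite ltnS ltnW|exact: cf].
by apply/funext => x; rewrite big_ord_recr.
Qed.

End Frechet.

Section Bilinear.
Variable R : realType.
Implicit Types X Y Z W : normedModType R.

Definition bounded_bilinear Y Z W (B : Y -> Z -> W) :=
  [/\ forall z, linear (B^~ z), forall y, linear (B y) &
      exists2 M, 0 <= M & forall y z, `|B y z| <= M * `|y| * `|z|].

(** The two terms of the product rule for [B] are again bounded bilinear, now with
    values in a space of linear maps; this is what lets the induction on the order
    of smoothness run over all bilinear maps at once. *)
Section Lift.
Variables (X Y Z W : normedModType R) (B : Y -> Z -> W).
Hypothesis bB : bounded_bilinear B.

Fact bil_left_linear (A : clin X Y) z : linear (fun h => B (A h) z).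
Proof. by move=> a u v; rewrite linearP; case: bB => Bl _ _; exact: Bl z _ _ _. Qed.

Fact bil_left_bounded (A : clin X Y) z :
  exists M, forall h, `|B (A h) z| <= M * `|h|.
Proof.
have [_ _ [M M0 BM]] := bB; exists (M * `|A| * `|z|) => h.
apply: (le_trans (BM _ _)); rewrite [leRHS]mulrAC.
rewrite ler_wpM2r//; rewrite -[leRHS]mulrA ler_wpM2l//.
exact: clin_normP.
Qed.

Definition bil_left A z : clin X W := mkclin (bil_left_linear A z) (bil_left_bounded A z).

Fact bil_right_linear y (C : clin X Z) : linear (fun h => B y (C h)).
Proof. by move=> a u v; rewrite linearP; case: bB => _ Br _; exact: Br y _ _ _. Qed.

Fact bil_right_bounded y (C : clin X Z) :
  exists M, forall h, `|B y (C h)| <= M * `|h|.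
Proof.
have [_ _ [M M0 BM]] := bB; exists (M * `|y| * `|C|) => h.
apply: (le_trans (BM _ _)).
rewrite -[leRHS]mulrA ler_wpM2l ?mulr_ge0//.
exact: clin_normP.
Qed.

Definition bil_right y C : clin X W := mkclin (bil_right_linear y C) (bil_right_bounded y C).

Lemma bil_left_bilinear : bounded_bilinear bil_left.
Proof.
have [Bl Br [M M0 BM]] := bB; split=> [z a u v|A a u v|].
- by apply/val_inj/funext => h /=; exact: Bl z a (u h) (v h).
- by apply/val_inj/funext => h /=; exact: Br (A h) a u v.
- exists M => // A z; apply: clin_norm_le => [|h]; first by rewrite !mulr_ge0.
  apply: (le_trans (BM _ _)); rewrite [leRHS]mulrAC.
  rewrite ler_wpM2r//; rewrite -[leRHS]mulrA ler_wpM2l//.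
  exact: clin_normP.
Qed.

Lemma bil_right_bilinear : bounded_bilinear bil_right.
Proof.
have [Bl Br [M M0 BM]] := bB; split=> [z a u v|A a u v|].
- by apply/val_inj/funext => h /=; exact: Bl (z h) a u v.
- by apply/val_inj/funext => h /=; exact: Br A a (u h) (v h).
- exists M => // y C; apply: clin_norm_le => [|h]; first by rewrite !mulr_ge0.
  apply: (le_trans (BM _ _)); rewrite -[leRHS]mulrA ler_wpM2l ?mulr_ge0//.
  exact: clin_normP.
Qed.

End Lift.

Lemma bilinearBl Y Z W (B : Y -> Z -> W) : bounded_bilinear B ->
  forall u v z, B (u - v) z = B u z - B v z.
Proof.
move=> [Bl _ _] u v z; have -> : u - v = -1 *: v + u by linear_identity R.
by have /= -> := Bl z (-1) v u; linear_identity R.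
Qed.

Lemma bilinearBr Y Z W (B : Y -> Z -> W) : bounded_bilinear B ->
  forall y u v, B y (u - v) = B y u - B y v.
Proof.
move=> [_ Br _] y u v; have -> : u - v = -1 *: v + u by linear_identity R.
by have -> := Br y (-1) v u; linear_identity R.
Qed.

Lemma bilinear_continuous X Y Z W (B : Y -> Z -> W) (f : X -> Y) (g : X -> Z) :
  bounded_bilinear B -> continuous f -> continuous g ->
  continuous (fun x => B (f x) (g x)).
Proof.
move=> bB cf cg x; have [_ _ [M M0 BM]] := bB.
pose u y := M * `|f y - f x| * `|g y| + M * `|f x| * `|g y - g x|.
have uB y : `|B (f y) (g y) - B (f x) (g x)| <= u y.
  have -> : B (f y) (g y) - B (f x) (g x) =
    B (f y - f x) (g y) + B (f x) (g y - g x).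
    by rewrite bilinearBl// bilinearBr//; linear_identity R.
  by apply: (le_trans (ler_normD _ _)); apply: lerD.
have u0 : u y @[y --> x] --> 0.
  rewrite (_ : 0 = M * `|f x - f x| * `|g x| + M * `|f x| * `|g x - g x|); last first.
    by rewrite !subrr !normr0 mulr0 mul0r add0r mulr0.
  apply: cvgD; apply: cvgM.
  - apply: cvgM; first exact: cvg_cst.
    by apply: cvg_norm; apply: cvgB; [exact: cf|exact: cvg_cst].
  - by apply: cvg_norm; exact: cg.
  - exact: cvg_cst.
  - by apply: cvg_norm; apply: cvgB; [exact: cg|exact: cvg_cst].
apply/cvgrPdist_le => /= e e0.
move/cvgrPdist_le : u0 => /(_ e e0); apply: filterS => y.
rewrite sub0r normrN => uy; rewrite distrC (le_trans (uB y))//.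
exact: le_trans (ler_norm _) uy.
Qed.

Lemma has_frechet_lip X Z (f : X -> Z) x L : has_frechet f x L ->
  exists2 d : R, 0 < d & forall h, `|h| < d -> `|f (x + h) - f x| <= (`|L| + 1) * `|h|.
Proof.
move=> /(_ 1 ltr01)[d d0 fd]; exists d => // h /fd hd.
rewrite -[_ - _](subrK (L h)); apply: (le_trans (ler_normD _ _)).
by rewrite mulrDl addrC lerD// clin_normP.
Qed.

Lemma has_frechet_bil X Y Z W (B : Y -> Z -> W) (bB : bounded_bilinear B)
    (f : X -> Y) (g : X -> Z) x A C :
  has_frechet f x A -> has_frechet g x C ->
  has_frechet (fun y => B (f y) (g y)) x
    (bil_left bB A (g x) + bil_right bB (f x) C).
Proof.
move=> fA gC e e0; have [_ _ [M M0 BM]] := bB.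
pose K := M * (`|g x| + `|f x|) + 1.
have K0 : 0 < K by rewrite ltr_wpDl// mulr_ge0// addr_ge0.
have e1 : 0 < e / (2 * K) by rewrite divr_gt0// mulr_gt0.
have [d1 d10 fd] := fA _ e1; have [d2 d20 gd] := gC _ e1.
have [d3 d30 fl] := has_frechet_lip fA; have [d4 d40 gl] := has_frechet_lip gC.
pose K' := M * ((`|A| + 1) * (`|C| + 1)) + 1.
have K'0 : 0 < K' by rewrite ltr_wpDl// !mulr_ge0// addr_ge0.
have d50 : 0 < e / (2 * K') by rewrite divr_gt0// mulr_gt0.
exists (Num.min d1 (Num.min d2 (Num.min d3 (Num.min d4 (e / (2 * K')))))).
  by rewrite !lt_min d10 d20 d30 d40.
move=> h; rewrite !lt_min => /and5P[/fd h1 /gd h2 /fl h3 /gl h4 h5].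
have -> : B (f (x + h)) (g (x + h)) - B (f x) (g x) -
  (bil_left bB A (g x) + bil_right bB (f x) C) h =
  B (f (x + h) - f x - A h) (g x) + B (f x) (g (x + h) - g x - C h) +
  B (f (x + h) - f x) (g (x + h) - g x).
  by rewrite clinD /= !(bilinearBl bB) !(bilinearBr bB); linear_identity R.
have H1 : `|B (f (x + h) - f x - A h) (g x)| <= M * `|g x| * (e / (2 * K) * `|h|).
  by apply: (le_trans (BM _ _)); rewrite mulrAC ler_wpM2l ?mulr_ge0.
have H2 : `|B (f x) (g (x + h) - g x - C h)| <= M * `|f x| * (e / (2 * K) * `|h|).
  by apply: (le_trans (BM _ _)); rewrite ler_wpM2l ?mulr_ge0.
have H3 : `|B (f (x + h) - f x) (g (x + h) - g x)| <=
    M * ((`|A| + 1) * `|h|) * ((`|C| + 1) * `|h|).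
  apply: (le_trans (BM _ _)); apply: ler_pM; rewrite ?mulr_ge0//.
  by rewrite ler_wpM2l.
apply: le_trans (ler_normD _ _) _.
apply: le_trans (lerD (ler_normD _ _) (lexx _)) _.
apply: le_trans (lerD (lerD H1 H2) H3) _.
have T1 : M * (`|g x| + `|f x|) * (e / (2 * K)) <= e / 2.
  rewrite [leRHS](_ : _ = K * (e / (2 * K))).
    by apply: ler_wpM2r; [exact: ltW|rewrite /K lerDl].
  by field; rewrite gt_eqF.
have T2 : M * ((`|A| + 1) * (`|C| + 1)) * `|h| <= e / 2.
  rewrite [leRHS](_ : _ = K' * (e / (2 * K'))).
    by rewrite ler_pM ?mulr_ge0 ?addr_ge0//; [rewrite /K' lerDl|exact: ltW].
  by field; rewrite gt_eqF.
have -> : M * `|g x| * (e / (2 * K) * `|h|) + M * `|f x| * (e / (2 * K) * `|h|) +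
  M * ((`|A| + 1) * `|h|) * ((`|C| + 1) * `|h|) =
  (M * (`|g x| + `|f x|) * (e / (2 * K)) + M * ((`|A| + 1) * (`|C| + 1)) * `|h|) * `|h|.
  ring.
by rewrite ler_wpM2r// [leRHS]splitr lerD.
Qed.

(** Products, scalings and compositions of linear maps are all instances, and so is
    the derivative of a composite in [Ck_comp]. *)
Lemma Ck_bil n X Y Z W (B : Y -> Z -> W) (f : X -> Y) (g : X -> Z) :
  bounded_bilinear B -> Ck n f -> Ck n g -> Ck n (fun x => B (f x) (g x)).
Proof.
elim: n X Y Z W B f g => [|n IH] X Y Z W B f g bB cf cg.
  exact: bilinear_continuous.
have [df cf'] := cf; have [dg cg'] := cg.
apply: (@Ck_step _ _ _ _ _ (fun x => bil_left bB (frechet f x) (g x) +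
   bil_right bB (f x) (frechet g x))) => [x|].
  by apply: has_frechet_bil; exact: frechet_has.
apply: CkD.
- by apply: IH (Ck_pred cg) => //; exact: bil_left_bilinear.
- by apply: IH (Ck_pred cf) cg'; exact: bil_right_bilinear.
Qed.

Lemma scale_bilinear Z : bounded_bilinear (fun (a : R^o) (z : Z) => a *: z).
Proof.
split=> [z a u v|a b u v|].
- by rewrite scalerDl scalerA.
- by rewrite scalerDr !scalerA mulrC.
- by exists 1 => // a z; rewrite normrZ mul1r.
Qed.

Lemma CkZ n X Z (f : X -> R^o) (g : X -> Z) :
  Ck n f -> Ck n g -> Ck n (fun x => f x *: g x).
Proof. by move=> cf cg; apply: (Ck_bil (@scale_bilinear Z)). Qed.

Lemma CkM n X (f g : X -> R^o) :
  Ck n f -> Ck n g -> Ck n (fun x => f x * g x : R^o).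
Proof. exact: CkZ. Qed.

Fact comp_linear X Y Z (A : clin Y Z) (C : clin X Y) : linear (fun h => A (C h)).
Proof. by move=> a u v; rewrite !linearP. Qed.

Fact comp_bounded X Y Z (A : clin Y Z) (C : clin X Y) :
  exists M, forall h, `|A (C h)| <= M * `|h|.
Proof.
exists (`|A| * `|C|) => h; apply: (le_trans (clin_normP _ _)).
by rewrite -mulrA ler_wpM2l// clin_normP.
Qed.

Definition clin_comp X Y Z (A : clin Y Z) (C : clin X Y) : clin X Z :=
  mkclin (comp_linear A C) (comp_bounded A C).

Lemma clin_comp_bilinear X Y Z : bounded_bilinear (@clin_comp X Y Z).
Proof.
split=> [C a u v|A a u v|].
- by apply/val_inj/funext => h.
- by apply/val_inj/funext => h /=; rewrite linearP.
- exists 1 => // A C; apply: clin_norm_le => [|h]; first by rewrite !mulr_ge0.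
  apply: (le_trans (clin_normP A _)).
  by rewrite mul1r -mulrA ler_wpM2l// clin_normP.
Qed.

Lemma has_frechet_comp X Y Z (f : Y -> Z) (g : X -> Y) x A C :
  has_frechet f (g x) A -> has_frechet g x C ->
  has_frechet (f \o g) x (clin_comp A C).
Proof.
move=> fA gC e e0.
have [d1 d10 gl] := has_frechet_lip gC.
have C0 : 0 < `|C| + 1 by rewrite ltr_wpDl.
have e1 : 0 < e / (2 * (`|C| + 1)) by rewrite divr_gt0// mulr_gt0.
have e2 : 0 < e / (2 * (`|A| + 1)) by rewrite divr_gt0// mulr_gt0// ltr_wpDl.
have [d2 d20 fd] := fA _ e1; have [d3 d30 gd] := gC _ e2.
exists (Num.min d1 (Num.min d3 (d2 / (`|C| + 1)))).
  by rewrite !lt_min d10 d30 divr_gt0.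
move=> h; rewrite !lt_min => /and3P[/gl h1 /gd h3]; rewrite ltr_pdivlMr// => h2.
have k2 : `|g (x + h) - g x| < d2 by apply: (le_lt_trans h1); rewrite mulrC.
have := fd _ k2; rewrite [g x + _]addrC subrK => h4.
have -> : (f \o g) (x + h) - (f \o g) x - clin_comp A C h =
  (f (g (x + h)) - f (g x) - A (g (x + h) - g x)) + A (g (x + h) - g x - C h).
  by rewrite /= !linearB/=; linear_identity R.
apply: (le_trans (ler_normD _ _)); rewrite (splitr e) mulrDl; apply: lerD.
  apply: (le_trans h4).
  apply: (@le_trans _ _ (e / (2 * (`|C| + 1)) * ((`|C| + 1) * `|h|))).
    by rewrite ler_wpM2l// ltW.
  by rewrite le_eqVlt; apply/orP; left; apply/eqP; field; rewrite gt_eqF.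
apply: (le_trans (clin_normP _ _)).
apply: (@le_trans _ _ ((`|A| + 1) * (e / (2 * (`|A| + 1)) * `|h|))).
  by rewrite ler_pM// lerDl.
by rewrite le_eqVlt; apply/orP; left; apply/eqP; field; rewrite gt_eqF// ltr_wpDl.
Qed.

Lemma Ck_comp n X Y Z (f : Y -> Z) (g : X -> Y) :
  Ck n f -> Ck n g -> Ck n (f \o g).
Proof.
elim: n X Y Z f g => [|n IH] X Y Z f g cf cg.
  by move=> x; apply: continuous_comp; [exact: cg|exact: cf].
have [df cf'] := cf; have [dg cg'] := cg.
apply: (@Ck_step _ _ _ _ _ (fun x => clin_comp ((frechet f \o g) x) (frechet g x))) => [x|].
  by apply: has_frechet_comp; exact: frechet_has.
apply: Ck_bil cg'; first exact: clin_comp_bilinear.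
by apply: IH => //; exact: Ck_pred.
Qed.

End Bilinear.

(** * Smoothing by averages of translates *)

Section GeometricSequences.
Variable R : realType.

Lemma half_pow_lt (K e : R) : 0 < e -> exists m, forall n, (m <= n)%N -> K * 2^-1 ^+ n < e.
Proof.
move=> e0.
have h1 : `|2^-1 : R| < 1 by rewrite ger0_norm ?invr_ge0// invf_lt1// ltr1n.
have /cvgrPdist_lt/(_ e e0)[m _ hm] : K * 2^-1 ^+ n @[n --> \oo] --> (K * 0 : R).
  by apply: cvgMr; exact: cvg_expr h1.
exists m => n /hm; rewrite mulr0 sub0r normrN; apply: le_lt_trans.
exact: ler_norm.
Qed.

Lemma le_half_pow (a b K : R) : (forall m, a <= b + K * 2^-1 ^+ m) -> a <= b.
Proof.
move=> ab; rewrite leNgt; apply/negP => ba.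
have [m /(_ m (leqnn m))] := half_pow_lt K (eqbRL (subr_gt0 _ _) ba).
by rewrite ltNge lerBlDl ab.
Qed.

Lemma norm_lim_le (Z : normedModType R) (u : nat -> Z) l c rho N :
  u @ \oo --> l -> (forall n, (N <= n)%N -> `|u n - c| <= rho) -> `|l - c| <= rho.
Proof.
move=> ul uc; have : `|u n - c| @[n --> \oo] --> `|l - c|.
  by apply: cvg_norm; apply: cvgB => //; exact: cvg_cst.
move=> H; apply: (cvgr_to_le H); exists N => // n /=; exact: uc.
Qed.

Lemma geometric_cvgn (Z : completeNormedModType R) (u : nat -> Z) C :
  (forall m, `|u m.+1 - u m| <= C * 2^-1 ^+ m) ->
  cvgn u /\ forall m, `|limn u - u m| <= 2 * C * 2^-1 ^+ m.
Proof.
move=> uC.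
have C0 : 0 <= C by have := uC 0%N; rewrite expr0 mulr1; apply: le_trans.
have H m k : `|u (m + k)%N - u m| <= 2 * C * (2^-1 ^+ m - 2^-1 ^+ (m + k)).
  elim: k => [|k IH]; first by rewrite addn0 !subrr normr0 mulr0.
  rewrite addnS -(subrK (u (m + k)%N) (u _)) -addrA.
  apply: le_trans (ler_normD _ _) _; apply: le_trans (lerD (uC _) IH) _.
  by rewrite exprS; lra.
have H' m n : (m <= n)%N -> `|u n - u m| <= 2 * C * 2^-1 ^+ m.
  move=> mn; have := H m (n - m)%N; rewrite subnKC// => /le_trans; apply.
  by rewrite ler_wpM2l ?mulr_ge0// gerBl exprn_ge0// invr_ge0.
have cu : cvgn u.
  apply: cauchy_cvg; apply: cauchy_exP => e e0.
  have [m hm] := half_pow_lt (2 * C) e0; exists (u m).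
  exists m => // n /= mn; rewrite -ball_normE /ball_ /= distrC.
  exact: le_lt_trans (H' _ _ mn) (hm m (leqnn m)).
by split=> // m; apply: (norm_lim_le (N := m) cu); exact: H'.
Qed.

End GeometricSequences.

Definition Lip (R : realType) (X Z : normedModType R) (L : R) (f : X -> Z) :=
  forall x y, `|f x - f y| <= L * `|x - y|.

Section SegmentAverage.
Variables (R : realType) (X : normedModType R) (Z : completeNormedModType R).
Implicit Types (F : X -> Z) (d : X) (L : R).

(** Dyadic Riemann sums of the integral of [F] over the segment from [x] to
    [x + d]; for a Lipschitz map they converge geometrically. *)
Definition riemann_sum m d F x : Z :=
  2^-1 ^+ m *: \sum_(j < 2 ^ m) F (x + (j%:R * 2^-1 ^+ m) *: d).

Definition average d F x : Z := limn (fun m => riemann_sum m d F x).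

Let h_ge0 m : 0 <= 2^-1 ^+ m :> R. Proof. by rewrite exprn_ge0// invr_ge0. Qed.

Let hN m : (2 ^ m)%:R * 2^-1 ^+ m = 1 :> R.
Proof. by rewrite natrX -exprMn mulfV// expr1n. Qed.

Lemma mean_norm_le m (G : nat -> Z) rho :
  (forall j, (j < 2 ^ m)%N -> `|G j| <= rho) ->
  `|(2^-1 ^+ m : R) *: \sum_(j < 2 ^ m) G j| <= rho.
Proof.
move=> Gr; rewrite normrZ ger0_norm ?h_ge0//.
apply: (@le_trans _ _ (2^-1 ^+ m * ((2 ^ m)%:R * rho))); last first.
  by rewrite mulrA [_ * _%:R]mulrC hN mul1r.
rewrite ler_wpM2l//; apply: le_trans (ler_norm_sum _ _ _) _.
apply: le_trans (ler_sum _ (fun (i : 'I_(2 ^ m)) _ => Gr i (ltn_ord i))) _.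
by rewrite sumr_const card_ord mulr_natl.
Qed.

Lemma riemann_sum_step m d F L x : Lip L F ->
  `|riemann_sum m.+1 d F x - riemann_sum m d F x| <= L * `|d| * 2^-1 ^+ m.
Proof.
move=> FL.
have dbl (G : nat -> Z) n : \sum_(j < n * 2) G j =
    \sum_(j < n) (G (2 * j)%N + G (2 * j).+1).
  elim: n => [|n IH]; first by rewrite mul0n !big_ord0.
  by rewrite mulSn !big_ord_recr/= IH -addrA mulnC.
rewrite /riemann_sum expnSr.
rewrite (dbl (fun j => F (x + (j%:R * 2^-1 ^+ m.+1) *: d))).
have -> : (2^-1 ^+ m.+1 : R) *: \sum_(j < 2 ^ m)
   (F (x + ((2 * j)%:R * 2^-1 ^+ m.+1) *: d) +
    F (x + ((2 * j).+1%:R * 2^-1 ^+ m.+1) *: d)) -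
   2^-1 ^+ m *: \sum_(j < 2 ^ m) F (x + (j%:R * 2^-1 ^+ m) *: d) =
   2^-1 ^+ m *: \sum_(j < 2 ^ m) (2^-1 *: (F (x + ((2 * j).+1%:R * 2^-1 ^+ m.+1) *: d)
     - F (x + (j%:R * 2^-1 ^+ m) *: d))).
  rewrite exprSr -scalerA -scalerBr scaler_sumr -sumrB; congr (_ *: _).
  apply: eq_bigr => j _.
  have -> : (2 * j)%:R * (2^-1 ^+ m * 2^-1) = j%:R * 2^-1 ^+ m :> R.
    by rewrite natrM; field.
  by linear_identity R.
apply: (mean_norm_le (G := fun j => 2^-1 *: (F (x + ((2 * j).+1%:R * 2^-1 ^+ m.+1) *: d)
     - F (x + (j%:R * 2^-1 ^+ m) *: d)))) => j _.
rewrite normrZ ger0_norm ?invr_ge0//.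
apply: le_trans (ler_wpM2l _ (FL _ _)) _; first by rewrite invr_ge0.
have -> : x + ((2 * j).+1%:R * 2^-1 ^+ m.+1) *: d - (x + (j%:R * 2^-1 ^+ m) *: d)
   = (2^-1 ^+ m.+1) *: d.
  by rewrite -natr1 natrM exprSr; linear_identity R.
have L0 : 0 <= L * `|d|.
  by rewrite -[d in `|d|]subr0; apply: le_trans (FL d 0).
by rewrite normrZ ger0_norm// exprSr; have := h_ge0 m; nra.
Qed.

Lemma average_cvg d F L x : Lip L F ->
  riemann_sum m d F x @[m --> \oo] --> average d F x.
Proof. by move=> FL; case: (geometric_cvgn (fun m => riemann_sum_step m d x FL)). Qed.

Lemma average_dist d F L x m : Lip L F ->
  `|average d F x - riemann_sum m d F x| <= 2 * (L * `|d|) * 2^-1 ^+ m.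
Proof. by move=> FL; case: (geometric_cvgn (fun m => riemann_sum_step m d x FL)). Qed.

(** Averaging preserves every affine inequality between translates that holds on
    the segment; the Lipschitz, nearness and difference-quotient estimates below
    are all of this shape. *)
Lemma average_le d F F1 L L1 x v (a s : R) c rho : Lip L F -> Lip L1 F1 ->
  (forall y, `|y - x| <= `|d| -> `|F (y + v) - a *: F y - s *: F1 y - c| <= rho) ->
  `|average d F (x + v) - a *: average d F x - s *: average d F1 x - c| <= rho.
Proof.
move=> FL FL1 H.
have cu : riemann_sum m d F (x + v) - a *: riemann_sum m d F x
    - s *: riemann_sum m d F1 x @[m --> \oo] -->
    average d F (x + v) - a *: average d F x - s *: average d F1 x.
  apply: cvgB; [apply: cvgB|].
  - exact: average_cvg FL.
  - by apply: cvgZ; [exact: cvg_cst|exact: average_cvg FL].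
  - by apply: cvgZ; [exact: cvg_cst|exact: average_cvg FL1].
apply: (norm_lim_le (N := 0%N) cu) => m _.
have -> : riemann_sum m d F (x + v) - a *: riemann_sum m d F x
    - s *: riemann_sum m d F1 x - c = 2^-1 ^+ m *: \sum_(j < 2 ^ m)
    (F ((x + (j%:R * 2^-1 ^+ m) *: d) + v) - a *: F (x + (j%:R * 2^-1 ^+ m) *: d)
     - s *: F1 (x + (j%:R * 2^-1 ^+ m) *: d) - c).
  have Ec : (2^-1 ^+ m : R) *: (c *+ 2 ^ m) = c.
    by rewrite -[c *+ _]scaler_nat scalerA mulrC hN scale1r.
  rewrite /riemann_sum !sumrB sumr_const card_ord !scalerBr Ec -!scaler_sumr.
  rewrite !(scalerA a) !(scalerA s) [a * _]mulrC [s * _]mulrC -!(scalerA (_ ^+ _)).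
  congr (_ *: _ - _ - _ - _); apply: eq_bigr => j _.
  by congr F; rewrite addrAC.
apply: (mean_norm_le (G := fun j => F ((x + (j%:R * 2^-1 ^+ m) *: d) + v)
  - a *: F (x + (j%:R * 2^-1 ^+ m) *: d) - s *: F1 (x + (j%:R * 2^-1 ^+ m) *: d) - c)).
move=> j jm; apply: H; rewrite addrC addKr normrZ ler_piMl//.
by rewrite ger0_norm ?mulr_ge0// -[leRHS](hN m) ler_wpM2r// ler_nat ltnW.
Qed.

End SegmentAverage.

Section SegmentAverageQuotient.
Variables (R : realType) (X : normedModType R) (Z : completeNormedModType R).
Implicit Types (F : X -> Z) (d : X) (L : R).

(** [F1] is the derivative of [F] along [e], with a uniform quadratic remainder; in
    contrast to differentiability, this is preserved by averages and limits. *)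
Definition quotient_estimate F F1 (e : X) (C : R) :=
  forall x s, `|F (x + s *: e) - F x - s *: F1 x| <= C * s ^+ 2.

Lemma average_near d F L x c rho : Lip L F ->
  (forall y, `|y - x| <= `|d| -> `|F y - c| <= rho) -> `|average d F x - c| <= rho.
Proof.
move=> FL H; have := @average_le _ _ _ d F F L L x 0 0 0 c rho FL FL.
rewrite addr0 !scale0r !subr0; apply => y /H.
by rewrite addr0 !scale0r !subr0.
Qed.

Lemma average_Lip d F L : Lip L F -> Lip L (average d F).
Proof.
move=> FL x y.
have := @average_le _ _ _ d F F L L y (x - y) 1 0 0 (L * `|x - y|) FL FL.
rewrite (addrC y) subrK !scale0r !scale1r !subr0; apply => z _.
rewrite !scale0r scale1r !subr0; apply: le_trans (FL _ _) _.
by rewrite (addrC z) addrK.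
Qed.

(** A shift by a dyadic part of the segment only changes the sum at its two ends. *)
Lemma riemann_sum_shift m k d F x :
  riemann_sum m d F (x + (k%:R * 2^-1 ^+ m) *: d) - riemann_sum m d F x =
  2^-1 ^+ m *: \sum_(j < k) (F (x + (j%:R * 2^-1 ^+ m) *: d + d)
                             - F (x + (j%:R * 2^-1 ^+ m) *: d)).
Proof.
have H (G : nat -> Z) N n : \sum_(j < N) G (j + n)%N - \sum_(j < N) G j =
    \sum_(j < n) (G (j + N)%N - G j).
  elim: n => [|n IH].
    rewrite big_ord0; apply/eqP; rewrite subr_eq0; apply/eqP.
    by apply: eq_bigr => j _; rewrite addn0.
  rewrite big_ord_recr/= -IH [(n + N)%N]addnC.
  have -> : \sum_(j < N) G (j + n.+1)%N = \sum_(j < N) G (j + n)%N - G n + G (N + n)%N.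
    elim: N {IH} => [|N IH]; first by rewrite !big_ord0; linear_identity R.
    by rewrite !big_ord_recr/= IH addnS addSn; linear_identity R.
  by linear_identity R.
rewrite /riemann_sum -scalerBr; congr (_ *: _).
have := H (fun j => F (x + (j%:R * 2^-1 ^+ m) *: d)) (2 ^ m)%N k.
have -> : \sum_(j < 2 ^ m) F (x + ((j + k)%:R * 2^-1 ^+ m) *: d) =
  \sum_(j < 2 ^ m) F (x + (k%:R * 2^-1 ^+ m) *: d + (j%:R * 2^-1 ^+ m) *: d).
  by apply: eq_bigr => j _; congr F; rewrite natrD; linear_identity R.
move=> ->; apply: eq_bigr => j _; congr (F _ - _).
have hN : (2 ^ m)%:R * 2^-1 ^+ m = 1 :> R by rewrite natrX -exprMn mulfV// expr1n.
by rewrite natrD mulrDl hN scalerDl scale1r addrA.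
Qed.

(** The average over the segment from [x] to [x + d] is an integral, so its
    derivative along [d] is the increment of [F] between the two end points. *)
Lemma average_quotient_self d F L : Lip L F ->
  quotient_estimate (average d F) (fun x => F (x + d) - F x) d (4 * L * `|d|).
Proof.
move=> FL.
have Ld0 : 0 <= L * `|d|.
  by rewrite -[d in `|d|]subr0; apply: le_trans (FL d 0).
have FD x : `|F (x + d) - F x| <= L * `|d|.
  by apply: le_trans (FL _ _) _; rewrite (addrC x) addrK.
have pos x s : 0 <= s ->
  `|average d F (x + s *: d) - average d F x - s *: (F (x + d) - F x)|
    <= 2 * (L * `|d|) * s ^+ 2.
  move=> s0; apply: (@le_half_pow _ _ _ (6 * (L * `|d|))) => m.
  pose h : R := 2^-1 ^+ m; rewrite -/h.
  have h0 : 0 < h by rewrite exprn_gt0// invr_gt0.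
  (* The step [s] is replaced by the nearest dyadic step below it. *)
  pose k := Num.truncn (s / h).
  have /andP[k1 k2] : k%:R <= s / h < k.+1%:R.
    by apply: truncn_itv; rewrite divr_ge0// ltW.
  pose sm := k%:R * h.
  have sm1 : sm <= s by rewrite -ler_pdivlMr.
  have sm2 : s - sm <= h.
    by move: k2; rewrite ltr_pdivrMr// -natr1 mulrDl mul1r -/sm => /ltW; lra.
  have sm0 : 0 <= sm by rewrite mulr_ge0// ltW.
  have E1 : `|riemann_sum m d F (x + sm *: d) - riemann_sum m d F x -
      sm *: (F (x + d) - F x)| <= 2 * (L * `|d|) * s ^+ 2.
    rewrite riemann_sum_shift -/h.
    have -> : h *: (\sum_(j < k) (F (x + (j%:R * h) *: d + d) - F (x + (j%:R * h) *: d))) -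
       sm *: (F (x + d) - F x) = h *: \sum_(j < k)
       ((F (x + d + (j%:R * h) *: d) - F (x + d)) - (F (x + (j%:R * h) *: d) - F x)).
      rewrite /sm mulrC -scalerA -scalerBr scaler_nat; congr (_ *: _).
      rewrite -[k in _ *+ k]card_ord -sumr_const -sumrB; apply: eq_bigr => j _.
      by rewrite (addrAC x d); linear_identity R.
    rewrite normrZ gtr0_norm//.
    apply: (@le_trans _ _ (h * (\sum_(j < k) (2 * (L * `|d|) * s)))).
      apply: ler_wpM2l; first exact: ltW.
      apply: le_trans (ler_norm_sum _ _ _) _.
      apply: ler_sum => j _; apply: le_trans (ler_normB _ _) _.
      have js : j%:R * h <= s.
        by apply: le_trans sm1; apply: ler_wpM2r; [exact: ltW|rewrite ler_nat ltnW].
      have B y : `|F (y + (j%:R * h) *: d) - F y| <= L * `|d| * s.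
        apply: le_trans (FL _ _) _; rewrite (addrC y) addrK normrZ ger0_norm.
          by rewrite mulrCA mulrC ler_wpM2l.
        by rewrite mulr_ge0// ltW.
      by have := B x; have := B (x + d); lra.
    rewrite sumr_const card_ord -[_ *+ k]mulr_natl mulrCA.
    have -> : k%:R * (h * (2 * (L * `|d|) * s)) = 2 * (L * `|d|) * (sm * s).
      by rewrite /sm; ring.
    by apply: ler_wpM2l; [exact: mulr_ge0|rewrite expr2 ler_wpM2r].
  have E2 : `|average d F (x + s *: d) - average d F (x + sm *: d)| <= L * `|d| * h.
    apply: le_trans (average_Lip d FL _ _) _.
    have -> : x + s *: d - (x + sm *: d) = (s - sm) *: d by linear_identity R.
    by rewrite normrZ ger0_norm ?subr_ge0// mulrCA mulrC ler_wpM2l.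
  have E3 := average_dist d (x + sm *: d) m FL; rewrite -/h in E3.
  have E4 := average_dist d x m FL; rewrite -/h in E4.
  have E5 : `|(s - sm) *: (F (x + d) - F x)| <= L * `|d| * h.
    rewrite normrZ ger0_norm ?subr_ge0// mulrC ler_pM// ?subr_ge0//.
  have -> : average d F (x + s *: d) - average d F x - s *: (F (x + d) - F x) =
    (average d F (x + s *: d) - average d F (x + sm *: d)) +
    (average d F (x + sm *: d) - riemann_sum m d F (x + sm *: d)) +
    (riemann_sum m d F (x + sm *: d) - riemann_sum m d F x - sm *: (F (x + d) - F x)) -
    (average d F x - riemann_sum m d F x) - (s - sm) *: (F (x + d) - F x).
    by linear_identity R.
  apply: le_trans (ler_normB _ _) _; apply: le_trans (lerD (ler_normB _ _) (lexx _)) _.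
  apply: le_trans (lerD (lerD (ler_normD _ _) (lexx _)) (lexx _)) _.
  apply: le_trans (lerD (lerD (lerD (ler_normD _ _) (lexx _)) (lexx _)) (lexx _)) _.
  lra.
move=> x s; have [s0|s0] := leP 0 s.
  apply: le_trans (pos x s s0) _; have := sqr_ge0 s; nra.
(* A negative step is a positive step from the other end of the segment. *)
have := pos (x + s *: d) (- s).
rewrite oppr_ge0 ltW// => /(_ isT).
have -> : x + s *: d + - s *: d = x by linear_identity R.
have E x1 : `|F (x1 + s *: d) - F x1| <= L * `|d| * - s.
  apply: le_trans (FL _ _) _; rewrite (addrC x1) addrK normrZ ltr0_norm//.
  by rewrite mulrCA mulrC.
move=> H.
have -> : average d F (x + s *: d) - average d F x - s *: (F (x + d) - F x) =
  - (average d F x - average d F (x + s *: d) -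
     - s *: (F (x + s *: d + d) - F (x + s *: d))) +
  s *: ((F (x + d + s *: d) - F (x + d)) - (F (x + s *: d) - F x)).
  by rewrite (addrAC x d); linear_identity R.
apply: le_trans (ler_normD _ _) _; rewrite normrN normrZ ltr0_norm//.
have T := ler_normB (F (x + d + s *: d) - F (x + d)) (F (x + s *: d) - F x).
have E1 := E x; have E2 := E (x + d); rewrite sqrrN in H.
have s0' : 0 <= - s by lra.
apply: le_trans (lerD H (ler_wpM2l s0' (le_trans T (lerD E2 E1)))) _.
by lra.
Qed.

End SegmentAverageQuotient.

Section Smoothing.
Variables (R : realType) (X : normedModType R) (Z : completeNormedModType R).
Implicit Types (f g : X -> Z) (d : nat -> X) (L rho : R).

Fixpoint iter_average d f m : X -> Z :=
  if m is n.+1 then average (d n) (iter_average d f n) else f.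

Definition smoothing d f x : Z := limn (fun m => iter_average d f m x).

Definition geometric_steps rho d := forall m, `|d m| <= rho * 2^-1 ^+ m.

Lemma iter_average_Lip d f L m : Lip L f -> Lip L (iter_average d f m).
Proof. by move=> fL; elim: m => //= m IH; exact: average_Lip. Qed.

Lemma smoothing_cvg d f L rho x : 0 <= L -> Lip L f -> geometric_steps rho d ->
  iter_average d f m x @[m --> \oo] --> smoothing d f x.
Proof.
move=> L0 fL drho.
suff : forall m, `|iter_average d f m.+1 x - iter_average d f m x| <= L * rho * 2^-1 ^+ m.
  by move=> /geometric_cvgn[].
move=> m; apply: (average_near (iter_average_Lip _ _ fL)) => y yx.
apply: le_trans (iter_average_Lip d m fL _ _) _.
by rewrite -mulrA ler_wpM2l// (le_trans yx).
Qed.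

Lemma iter_average_le d f f1 L L1 x v (a s : R) c b m : Lip L f -> Lip L1 f1 ->
  (forall y, `|y - x| <= \sum_(j < m) `|d j| ->
     `|f (y + v) - a *: f y - s *: f1 y - c| <= b) ->
  `|iter_average d f m (x + v) - a *: iter_average d f m x
     - s *: iter_average d f1 m x - c| <= b.
Proof.
move=> fL fL1; elim: m x => [|m IH] x H /=.
  by apply: H; rewrite subrr normr0 big_ord0.
apply: (average_le (iter_average_Lip _ _ fL) (iter_average_Lip _ _ fL1)) => y yx.
apply: IH => z zy; apply: H; rewrite big_ord_recr/=.
rewrite (_ : z - x = (z - y) + (y - x)); last by linear_identity R.
by apply: le_trans (ler_normD _ _) _; exact: lerD.
Qed.

Lemma geometric_steps_sum rho d m : geometric_steps rho d ->
  \sum_(j < m) `|d j| <= 2 * rho.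
Proof.
move=> drho; have rho0 : 0 <= rho.
  by have := drho 0%N; rewrite expr0 mulr1; apply: le_trans.
suff : \sum_(j < m) `|d j| <= 2 * rho * (1 - 2^-1 ^+ m).
  have h0 : 0 <= 2^-1 ^+ m :> R by rewrite exprn_ge0// invr_ge0.
  by nra.
elim: m => [|m IH]; first by rewrite big_ord0 subrr mulr0.
by rewrite big_ord_recr/= exprS; have := drho m; move: IH; lra.
Qed.

(** The total length of the steps is at most [2 * rho], so it is enough to know the
    inequality on a ball of this radius. *)
Lemma smoothing_le d f f1 L L1 rho x v (a s : R) c b :
  0 <= L -> 0 <= L1 -> Lip L f -> Lip L1 f1 -> geometric_steps rho d ->
  (forall y, `|y - x| <= 2 * rho ->
     `|f (y + v) - a *: f y - s *: f1 y - c| <= b) ->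
  `|smoothing d f (x + v) - a *: smoothing d f x - s *: smoothing d f1 x - c| <= b.
Proof.
move=> L0 L10 fL fL1 drho H.
have cu : iter_average d f m (x + v) - a *: iter_average d f m x
    - s *: iter_average d f1 m x @[m --> \oo] -->
    smoothing d f (x + v) - a *: smoothing d f x - s *: smoothing d f1 x.
  apply: cvgB; [apply: cvgB|].
  - exact: smoothing_cvg fL drho.
  - by apply: cvgZ; [exact: cvg_cst|exact: smoothing_cvg fL drho].
  - by apply: cvgZ; [exact: cvg_cst|exact: smoothing_cvg fL1 drho].
apply: (norm_lim_le (N := 0%N) cu) => m _.
apply: (iter_average_le fL fL1) => y /le_trans yx; apply: H; apply: yx.
exact: geometric_steps_sum.
Qed.

Lemma smoothing_near d f L rho x c b : 0 <= L -> Lip L f -> geometric_steps rho d ->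
  (forall y, `|y - x| <= 2 * rho -> `|f y - c| <= b) -> `|smoothing d f x - c| <= b.
Proof.
move=> L0 fL drho H.
have := @smoothing_le d f f L L rho x 0 0 0 c b L0 L0 fL fL drho.
rewrite addr0 !scale0r !subr0; apply => y /H.
by rewrite addr0 !scale0r !subr0.
Qed.

Lemma smoothing_Lip d f L rho : 0 <= L -> Lip L f -> geometric_steps rho d ->
  Lip L (smoothing d f).
Proof.
move=> L0 fL drho x y.
have := @smoothing_le d f f L L rho y (x - y) 1 0 0 (L * `|x - y|) L0 L0 fL fL drho.
rewrite (addrC y) subrK !scale0r !scale1r !subr0; apply => z _.
rewrite !scale0r scale1r !subr0; apply: le_trans (fL _ _) _.
by rewrite (addrC z) addrK.
Qed.

Lemma smoothing_quotient_estimate d f f1 L L1 rho e C :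
  0 <= L -> 0 <= L1 -> Lip L f -> Lip L1 f1 -> geometric_steps rho d ->
  quotient_estimate f f1 e C ->
  quotient_estimate (smoothing d f) (smoothing d f1) e C.
Proof.
move=> L0 L10 fL fL1 drho H x s.
have := @smoothing_le d f f1 L L1 rho x (s *: e) 1 s 0 (C * s ^+ 2) L0 L10 fL fL1 drho.
by rewrite scale1r subr0; apply => z _; rewrite scale1r subr0.
Qed.

Lemma smoothing_shift d f L rho j x : 0 <= L -> Lip L f -> geometric_steps rho d ->
  smoothing d f x = smoothing (fun m => d (m + j)%N) (iter_average d f j) x.
Proof.
move=> L0 fL drho.
have E m : iter_average d f (m + j) =
    iter_average (fun m => d (m + j)%N) (iter_average d f j) m.
  by elim: m => //= m ->.
rewrite /smoothing; apply/esym/(cvg_lim (@norm_hausdorff _ _)).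
rewrite (_ : (fun m => _) = fun m => iter_average d f (m + j) x); last first.
  by apply/funext => m; rewrite E.
rewrite (cvg_shiftn j (fun m => iter_average d f m x)).
exact: smoothing_cvg fL drho.
Qed.

Definition recurrent_directions (e : nat -> X) d :=
  forall i N, exists j r, [/\ (N <= j)%N, 0 < r & d j = r *: e i].

(** The class of smoothed functions is closed under taking partial derivatives
    along the vectors [e i], which is what makes them infinitely smooth on the
    spans of finitely many of these vectors. *)
Definition smoothed (e : nat -> X) g := exists f d L rho,
  [/\ 0 <= L, Lip L f, geometric_steps rho d, recurrent_directions e d &
      g = smoothing d f].

Lemma smoothed_Lip e g : smoothed e g -> exists2 L, 0 <= L & Lip L g.
Proof. by move=> [f [d [L [rho [L0 fL drho _ ->]]]]]; exists L => //; exact: smoothing_Lip drho. Qed.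

(** Average first along the steps up to the first multiple of [e i], differentiate
    there, and apply the remaining steps to the derivative. *)
Lemma smoothed_partial e g i : smoothed e g ->
  exists g1 C, [/\ smoothed e g1, 0 <= C & quotient_estimate g g1 (e i) C].
Proof.
move=> [f [d [L [rho [L0 fL drho de ->]]]]].
have [j [r [_ r0 dj]]] := de i 0%N.
pose F := iter_average d f j.
have FL : Lip L F by exact: iter_average_Lip.
pose F1 x := r^-1 *: (F (x + d j) - F x).
have F1L : Lip (r^-1 * (2 * L)) F1.
  move=> x y; rewrite /F1 -scalerBr normrZ gtr0_norm ?invr_gt0// -mulrA.
  apply: ler_wpM2l; first by rewrite invr_ge0 ltW.
  have -> : F (x + d j) - F x - (F (y + d j) - F y) =
    (F (x + d j) - F (y + d j)) - (F x - F y) by linear_identity R.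
  apply: le_trans (ler_normB _ _) _; have := FL x y; have := FL (x + d j) (y + d j).
  by rewrite (_ : x + d j - (y + d j) = x - y); [lra|linear_identity R].
pose d' m := d (m + j.+1)%N.
have d'rho : geometric_steps rho d'.
  move=> m; apply: (le_trans (drho (m + j.+1)%N)).
  have rho0 : 0 <= rho.
    by have := drho 0%N; rewrite expr0 mulr1; apply: le_trans.
  rewrite ler_wpM2l// exprD ler_piMr ?exprn_ge0 ?invr_ge0//.
  by rewrite exprn_ile1 ?invr_ge0// invf_le1// ler1n.
have F1L0 : 0 <= r^-1 * (2 * L) by rewrite !mulr_ge0// invr_ge0 ltW.
pose C := 4 * L * `|d j| * r^-1 ^+ 2.
exists (smoothing d' F1), C; split.
- exists F1, d', (r^-1 * (2 * L)), rho; split=> // k N.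
  have [l [t [Nl t0 dl]]] := de k (N + j.+1)%N.
  exists (l - j.+1)%N, t; split=> //; first by rewrite leq_subRL 1?addnC// (leq_trans _ Nl)// leq_addl.
  by rewrite /d' subnK// (leq_trans _ Nl)// leq_addl.
- by apply: mulr_ge0; [rewrite !mulr_ge0|rewrite exprn_ge0// invr_ge0 ltW].
have -> : smoothing d f = smoothing d' (iter_average d f j.+1).
  by apply/funext => x; exact: (smoothing_shift j.+1 x L0 fL drho).
apply: (smoothing_quotient_estimate L0 F1L0) => //.
  exact: iter_average_Lip.
move=> x s; rewrite /= -/F.
have := average_quotient_self (d j) FL x (s / r).
have -> : (s / r) *: d j = s *: e i by rewrite dj scalerA divfK ?gt_eqF.
rewrite /F1 scalerA.
by move/le_trans; apply; rewrite /C expr_div_n exprVn mulrA mulrAC.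
Qed.

Lemma smoothed_partials e g : smoothed e g -> exists g1 : nat -> X -> Z, exists C : nat -> R,
  forall i, [/\ smoothed e (g1 i), 0 <= C i & quotient_estimate g (g1 i) (e i) (C i)].
Proof.
move=> sg; have /choice[g1 H] i := smoothed_partial i sg.
by have /choice[C H'] := H; exists g1, C.
Qed.

End Smoothing.

Section SmoothedSpan.
Variables (R : realType) (X : normedModType R) (Z : completeNormedModType R).
Variable e : nat -> X.
Implicit Type g : X -> Z.

(** Lipschitz partial derivatives give a quadratic remainder on a finite span. *)
Lemma smoothed_expansion g (g1 : nat -> X -> Z) (C : nat -> R) N :
  (forall i, [/\ smoothed e (g1 i), 0 <= C i & quotient_estimate g (g1 i) (e i) (C i)]) ->
  exists2 K : R, 0 <= K & forall y (t : nat -> R),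
    `|g (y + \sum_(i < N) t i *: e i) - g y - \sum_(i < N) t i *: g1 i y|
      <= K * (\sum_(i < N) `|t i|) ^+ 2.
Proof.
move=> H; elim: N => [|N [K K0 IH]].
  by exists 0 => // y t; rewrite !big_ord0 addr0 subrr sub0r normrN normr0 mul0r.
have [g1N CN0 qN] := H N; have [L L0 LN] := smoothed_Lip g1N.
pose E := \sum_(i < N) `|e i|.
have E0 : 0 <= E by rewrite sumr_ge0.
exists (K + C N + L * E) => [|y t]; first by rewrite !addr_ge0// mulr_ge0.
rewrite !big_ord_recr/=; have := IH y t.
set S := \sum_(i < N) _ *: _; set T := \sum_(i < N) _ *: _.
set s := \sum_(i < N) `|t i| => HS.
have s0 : 0 <= s by rewrite sumr_ge0.
have SE : `|S| <= s * E.
  rewrite /s mulr_suml; apply: le_trans (ler_norm_sum _ _ _) _.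
  apply: ler_sum => i _; rewrite normrZ ler_wpM2l//.
  by rewrite /E (bigD1 i)//= lerDl sumr_ge0.
have H1 := qN (y + S) (t N).
have H2 : `|t N *: (g1 N (y + S) - g1 N y)| <= `|t N| * (L * (s * E)).
  rewrite normrZ ler_wpM2l//; apply: le_trans (LN _ _) _.
  by rewrite (addrC y) addrK ler_wpM2l.
have -> : g (y + (S + t N *: e N)) - g y - (T + t N *: g1 N y) =
  (g (y + S) - g y - T) + (g (y + S + t N *: e N) - g (y + S) - t N *: g1 N (y + S))
  + t N *: (g1 N (y + S) - g1 N y).
  by rewrite (addrA y); linear_identity R.
apply: le_trans (ler_normD _ _) _; apply: le_trans (lerD (ler_normD _ _) (lexx _)) _.
apply: le_trans (lerD (lerD HS H1) H2) _.
rewrite -(real_normK (num_real (t N))).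
have := normr_ge0 (t N); move: (`|t N|) => u u0.
have -> : K * s ^+ 2 + C N * u ^+ 2 + u * (L * (s * E)) =
  K * s ^+ 2 + C N * u ^+ 2 + L * E * (u * s) by ring.
have LE0 : 0 <= L * E by rewrite mulr_ge0.
have B1 : s ^+ 2 <= (s + u) ^+ 2 by nra.
have B2 : u ^+ 2 <= (s + u) ^+ 2 by nra.
have B3 : u * s <= (s + u) ^+ 2 by nra.
by rewrite !mulrDl !lerD// ler_wpM2l.
Qed.

(** The derivative is a sum of partial derivatives, which are smoothed functions
    again, multiplied by constant linear maps. *)
Lemma smoothed_Ck n (W : normedModType R) (a : nat -> clin W R^o) N g :
  smoothed e g -> Ck n (fun x => g (\sum_(i < N) a i x *: e i)).
Proof.
elim: n g => [|n IH] g sg; have [L L0 gL] := smoothed_Lip sg;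
    have [g1 [C H]] := smoothed_partials sg;
    have [K K0 HK] := smoothed_expansion N H.
  move=> x; have cP : continuous (fun x => \sum_(i < N) a i x *: e i).
    apply: (@Ck_continuous _ 0); apply: (@Ck_sum _ 0 _ _ N (fun i x => a i x *: e i)).
    by move=> i _; apply: CkZ; [exact: Ck_clin|exact: Ck_cst].
  apply: (@continuous_comp _ _ _ _ g); first exact: cP.
  apply/cvgrPdist_lt => eps eps0.
  have L1 : 0 < L + 1 by rewrite ltr_wpDl.
  apply/nbhs_normP; exists (eps / (L + 1)); first by rewrite /= divr_gt0.
  move=> y /=; rewrite ltr_pdivlMr// mulrC; apply: le_lt_trans.
  by apply: le_trans (gL _ _) _; rewrite ler_wpM2r// lerDl.
pose Tz i z := bil_left (scale_bilinear Z) (a i) z.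
apply: (@Ck_step _ _ _ _ _ (fun x => \sum_(i < N) Tz i (g1 i (\sum_(j < N) a j x *: e j)))).
  move=> x eps eps0; pose A : R := \sum_(i < N) `|a i|.
  have A0 : 0 <= A by rewrite sumr_ge0.
  have K1 : 0 < K * A ^+ 2 + 1 by rewrite ltr_wpDl// mulr_ge0// exprn_ge0.
  exists (eps / (K * A ^+ 2 + 1)); first by rewrite divr_gt0.
  move=> h; rewrite ltr_pdivlMr// => hh.
  rewrite (clin_sum N (fun i => Tz i (g1 i (\sum_(j < N) a j x *: e j)))).
  have -> : \sum_(i < N) a i (x + h) *: e i =
    \sum_(i < N) a i x *: e i + \sum_(i < N) a i h *: e i.
    by rewrite -big_split/=; apply: eq_bigr => i _; rewrite linearD/= scalerDl.
  apply: le_trans (HK _ (fun i => a i h)) _.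
  have B : \sum_(i < N) `|a i h| <= A * `|h|.
    by rewrite /A mulr_suml; apply: ler_sum => i _; exact: clin_normP.
  apply: (@le_trans _ _ (K * (A * `|h|) ^+ 2)).
    by rewrite ler_wpM2l// ler_sqr ?nnegrE ?sumr_ge0// mulr_ge0.
  rewrite (_ : K * _ = (`|h| * (K * A ^+ 2)) * `|h|); last by ring.
  rewrite ler_wpM2r//; apply: le_trans (ltW hh); rewrite ler_wpM2l//.
  by rewrite lerDl.
apply: (@Ck_sum _ n _ _ N (fun i x => Tz i (g1 i (\sum_(j < N) a j x *: e j)))) => i _.
apply: (Ck_bil (@bil_left_bilinear _ W _ _ _ _ (scale_bilinear Z))); first exact: Ck_cst.
by apply: IH; have [] := H i.
Qed.

Lemma recurrent_steps_exist (rho : R) : 0 < rho ->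
  exists2 d, geometric_steps rho d & recurrent_directions e d.
Proof.
move=> rho0.
(* Every [k] is the 2-adic valuation of arbitrarily large integers. *)
pose i m := logn 2 m.+1.
have p1 m : 0 < 1 + `|e (i m)| by rewrite ltr_pwDl.
have h0 m : 0 < rho * 2^-1 ^+ m by rewrite mulr_gt0// exprn_gt0// invr_gt0.
exists (fun m => (rho * 2^-1 ^+ m / (1 + `|e (i m)|)) *: e (i m)).
  move=> m; rewrite normrZ gtr0_norm ?divr_gt0// mulrAC ler_pdivrMr//.
  by apply: ler_wpM2l; [exact: ltW|rewrite lerDr].
move=> k N; pose j := (2 ^ k * (2 * N).+1).-1.
have jS : j.+1 = (2 ^ k * (2 * N).+1)%N by rewrite prednK// muln_gt0 expn_gt0.
have ij : i j = k.
  rewrite /i jS lognM ?expn_gt0// pfactorK// [X in (k + X)%N]lognE/=.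
  by rewrite dvdn2 /= oddM /= addn0.
exists j, (rho * 2^-1 ^+ j / (1 + `|e (i j)|)); split.
- rewrite -ltnS jS (leq_trans (_ : N.+1 <= (2 * N).+1)%N)//.
    by rewrite ltnS leq_pmull.
  by rewrite leq_pmull// expn_gt0.
- by rewrite divr_gt0.
- by rewrite ij.
Qed.

End SmoothedSpan.

Section SmoothStep.
Variable R : realType.

Let ramp (t : R^o) : R^o := Num.min 1 (Num.max 0 (4 * t - 1)).

Let ramp_cases t : [\/ (t <= 4^-1 /\ ramp t = 0), (4^-1 <= t <= 2^-1 /\ ramp t = 4 * t - 1)
  | (2^-1 <= t /\ ramp t = 1)].
Proof.
rewrite /ramp; have [h|h] := leP 0 (4 * t - 1); last first.
  by constructor 1; rewrite min_r ?ler01//; split=> //; lra.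
have [h'|h'] := leP 1 (4 * t - 1).
  by constructor 3; split=> //; lra.
by constructor 2; split=> //; lra.
Qed.

(** Smoothing a piecewise affine ramp with steps of total length [1 / 8] does not
    change it where it is constant on a ball of that radius. *)
Lemma smooth_step_exists : exists theta : R^o -> R^o,
  [/\ forall n, Ck n theta, Lip 4 theta, forall t, 0 <= theta t <= 1,
      forall t, t <= 8^-1 -> theta t = 0 & forall t, 5 / 8 <= t -> theta t = 1].
Proof.
have rL : Lip 4 ramp.
  move=> s t; rewrite ler_norml.
  have N1 := ler_norm (s - t); have N2 := ler_norm (t - s); rewrite distrC in N2.
  by apply/andP; case: (ramp_cases s) => -[hs ->]; case: (ramp_cases t) => -[ht ->]; split; lra.
pose e : nat -> R^o := fun=> 1.
have rho0 : 0 < 16^-1 :> R by rewrite invr_gt0.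
have [d dr de] := recurrent_steps_exist e rho0.
have L0 : 0 <= 4 :> R by [].
exists (smoothing d ramp); split.
- move=> n; have id_lin : linear (fun x : R^o => x) by [].
  have id_bd : exists M : R, forall x : R^o, `|x| <= M * `|x|.
    by exists 1 => x; rewrite mul1r.
  pose a (_ : nat) : clin R^o R^o := mkclin id_lin id_bd.
  have sg : smoothed e (smoothing d ramp) by exists ramp, d, 4, 16^-1.
  have := smoothed_Ck n a 1 sg.
  rewrite (_ : (fun x => _) = smoothing d ramp)//.
  by apply/funext => x; rewrite big_ord1 /= /e; congr smoothing; exact: mulr1.
- exact: smoothing_Lip dr.
- move=> t; have : `|smoothing d ramp t - 2^-1| <= 2^-1.
    apply: (smoothing_near L0 rL dr) => y _; rewrite ler_norml.
    by apply/andP; case: (ramp_cases y) => -[h ->]; split; lra.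
  by rewrite ler_norml => /andP[h1 h2]; apply/andP; split; lra.
- move=> t t8; apply/eqP; rewrite -subr_eq0 -normr_le0.
  apply: (smoothing_near L0 rL dr) => y; rewrite ler_norml => /andP[_ h].
  by rewrite ler_norml; apply/andP; case: (ramp_cases y) => -[h' ->]; split; lra.
- move=> t t8; apply/eqP; rewrite -subr_eq0 -normr_le0.
  apply: (smoothing_near L0 rL dr) => y; rewrite ler_norml => /andP[h _].
  by rewrite ler_norml; apply/andP; case: (ramp_cases y) => -[h' ->]; split; lra.
Qed.

End SmoothStep.

(** * Unconditional bases *)

Section BlockPermutation.
(** The integers are cut into consecutive blocks, the block that starts at [N]
    ending before [nx N]. The permutation lists, in each block, the elements selected
    by the mask [mk N] first, so that their sum is an increment of the partial sums
    of the rearranged series. *)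
Variables (nx : nat -> nat) (mk : nat -> nat -> bool).
Hypothesis nx_gt : forall N, (N < nx N)%N.

Let N k := iter k nx 0%N.
Let sel k := [seq v <- iota (N k) (nx (N k) - N k) | mk (N k) v].
Let block k := sel k ++ [seq v <- iota (N k) (nx (N k) - N k) | ~~ mk (N k) v].
Fixpoint flat m := if m is k.+1 then flat k ++ block k else [::].

Let NS k : N k.+1 = nx (N k). Proof. by []. Qed.

Let N_ge k : (k <= N k)%N.
Proof. by elim: k => // k /leq_ltn_trans; apply; rewrite NS. Qed.

Lemma flat_perm m : perm_eq (flat m) (iota 0 (N m)).
Proof.
elim: m => [//|m IH].
have -> : N m.+1 = (N m + (nx (N m) - N m))%N by rewrite subnKC// ltnW.
rewrite iotaD; apply: perm_cat => //; rewrite add0n.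
by rewrite /block; apply/permPl/perm_filterC.
Qed.

Lemma size_flat m : size (flat m) = N m.
Proof. by rewrite (perm_size (flat_perm m)) size_iota. Qed.

Lemma mem_flat m v : (v \in flat m) = (v < N m)%N.
Proof. by rewrite (perm_mem (flat_perm m)) mem_iota. Qed.

Lemma uniq_flat m : uniq (flat m).
Proof. by rewrite (perm_uniq (flat_perm m)) iota_uniq. Qed.

Let N_le k m : (k <= m)%N -> (N k <= N m)%N.
Proof.
move=> /subnK <-; elim: (m - k)%N => // j /leq_trans; apply.
by rewrite addSn NS ltnW.
Qed.

Lemma flat_prefix k m : (k <= m)%N -> exists s, flat m = flat k ++ s.
Proof.
move=> /subnK <-; elim: (m - k)%N => [|j [s IH]]; first by exists [::]; rewrite cats0.
by exists (s ++ block (j + k)); rewrite addSn /= IH catA.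
Qed.

Definition block_perm n := nth 0%N (flat n.+1) n.

Lemma nth_flat m n : (n < N m)%N -> nth 0%N (flat m) n = block_perm n.
Proof.
move=> nm; have nn : (n < N n.+1)%N by exact: N_ge.
rewrite /block_perm; have [mn|mn] := leqP m n.+1.
  by have [s ->] := flat_prefix mn; rewrite nth_cat size_flat nm.
by have [s ->] := flat_prefix (ltnW mn); rewrite nth_cat size_flat nn.
Qed.

Lemma block_perm_bij : bijective block_perm.
Proof.
have E m v : (v < N m)%N -> index v (flat m) = index v (flat v.+1).
  move=> vm; have vv : (v < N v.+1)%N by exact: N_ge.
  have [mn|mn] := leqP m v.+1.
    by have [s ->] := flat_prefix mn; rewrite index_cat mem_flat vm.
  by have [s ->] := flat_prefix (ltnW mn); rewrite index_cat mem_flat vv.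
exists (fun v => index v (flat v.+1)) => [n|v].
  have nn : (n < N n.+1)%N by exact: N_ge.
  rewrite -(E n.+1); first by rewrite index_uniq ?uniq_flat// size_flat.
  by rewrite -mem_flat mem_nth// size_flat.
have vv : (v < N v.+1)%N by exact: N_ge.
rewrite -(nth_flat (m := v.+1)).
  by rewrite nth_index// mem_flat.
by rewrite -size_flat index_mem mem_flat.
Qed.

Lemma block_perm_take m M : (M <= N m)%N ->
  [seq block_perm i | i <- iota 0 M] = take M (flat m).
Proof.
move=> Mm; apply: (@eq_from_nth _ 0%N).
  by rewrite size_map size_iota size_takel// size_flat.
move=> i; rewrite size_map size_iota => iM.
rewrite (nth_map 0%N) ?size_iota// nth_iota// nth_take// add0n nth_flat//.
exact: leq_trans iM Mm.
Qed.

Lemma block_perm_series (V : zmodType) (u : nat -> V) k :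
  exists M, \sum_(0 <= i < N k + M) u (block_perm i) - \sum_(0 <= i < N k) u (block_perm i)
    = \sum_(N k <= v < nx (N k) | mk (N k) v) u v.
Proof.
exists (size (sel k)).
have sM : (N k + size (sel k) <= N k.+1)%N.
  by rewrite -[N k.+1]size_flat /= !size_cat size_flat leq_add2l leq_addr.
have H M : (M <= N k.+1)%N -> \sum_(0 <= i < M) u (block_perm i) =
    \sum_(v <- take M (flat k.+1)) u v.
  by move=> /block_perm_take <-; rewrite big_map /index_iota subn0.
rewrite !H//; last by rewrite N_le.
have T1 : take (N k) (flat k.+1) = flat k by rewrite take_size_cat// size_flat.
have T2 : take (N k + size (sel k)) (flat k.+1) = flat k ++ sel k.
  by rewrite -[flat k.+1]/(flat k ++ block k) /block catA take_size_cat// size_cat size_flat.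
by rewrite T1 T2 big_cat/= addrAC subrr add0r big_filter.
Qed.

End BlockPermutation.

Section BoundedMultipliers.
Variables (R : realType) (V : normedModType R).
Implicit Type u : nat -> V.

(** The sum is an affine function of each [t n], so it is largest at the vertices of
    the cube, where the multiplier selects a subset. *)
Lemma multiplier_convex u (r : seq nat) (M : R) (c : V) :
  (forall b : nat -> bool, `|c + \sum_(n <- r | b n) u n| <= M) -> uniq r ->
  forall t : nat -> R, (forall n, 0 <= t n <= 1) ->
  `|c + \sum_(n <- r) t n *: u n| <= M.
Proof.
elim: r c => [|x r IH] c H rr t t01.
  by have := H xpredT; rewrite !big_nil.
move: rr; rewrite cons_uniq => /andP[xr rr].
have ch (b0 : bool) (b : nat -> bool) : \sum_(n <- x :: r | if n == x then b0 else b n) u n =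
    (if b0 then u x else 0) + \sum_(n <- r | b n) u n.
  rewrite big_cons eqxx; have -> : \sum_(n <- r | if n == x then b0 else b n) u n = \sum_(n <- r | b n) u n.
    rewrite big_seq_cond [RHS]big_seq_cond; apply: eq_bigl => n.
    by case: eqP => [->|//]; rewrite (negPf xr).
  by case: b0; rewrite ?add0r.
have H0 : `|c + \sum_(n <- r) t n *: u n| <= M.
  apply: IH => // b; have := H (fun n => if n == x then false else b n).
  by rewrite (ch false) add0r.
have H1 : `|c + u x + \sum_(n <- r) t n *: u n| <= M.
  apply: IH => // b; have := H (fun n => if n == x then true else b n).
  by rewrite (ch true) addrA.
rewrite big_cons; have /andP[tx0 tx1] := t01 x.
have -> : c + (t x *: u x + \sum_(n <- r) t n *: u n) =
  (1 - t x) *: (c + \sum_(n <- r) t n *: u n) + t x *: (c + u x + \sum_(n <- r) t n *: u n).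
  by linear_identity R.
apply: le_trans (ler_normD _ _) _; rewrite !normrZ (ger0_norm tx0) ger0_norm ?subr_ge0//.
by nra.
Qed.

Lemma multiplier_bound u (M : R) :
  (forall (b : nat -> bool) N, `|\sum_(0 <= n < N | b n) u n| <= M) ->
  forall (t : nat -> R), (forall n, `|t n| <= 1) ->
  forall N, `|\sum_(0 <= n < N) t n *: u n| <= 2 * M.
Proof.
move=> H t t1 N.
have P (s : nat -> R) : (forall n, 0 <= s n <= 1) -> `|\sum_(0 <= n < N) s n *: u n| <= M.
  move=> s01; rewrite -[X in `|X|]add0r; apply: multiplier_convex => // [b|].
    by rewrite add0r; exact: H.
  exact: iota_uniq.
pose tp n := if 0 <= t n then t n else 0; pose tn n := if 0 <= t n then 0 else - t n.
have -> : \sum_(0 <= n < N) t n *: u n =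
    \sum_(0 <= n < N) tp n *: u n - \sum_(0 <= n < N) tn n *: u n.
  rewrite -sumrB; apply: eq_bigr => n _; rewrite -scalerBl; congr (_ *: _).
  by rewrite /tp /tn; case: ifP => _; rewrite ?subr0 ?sub0r ?opprK.
apply: le_trans (ler_normB _ _) _; rewrite mulr_natl mulr2n; apply: lerD; apply: P => n;
  by have := t1 n; rewrite ler_norml /tp /tn => /andP[]; case: (leP 0 (t n)) => h *; apply/andP; split; lra.
Qed.

(** If the sums over subsets were unbounded, consecutive blocks would carry large
    sums over subsets, and listing these subsets first in their block would
    produce a divergent rearrangement. *)
Lemma unconditional_bounded u :
  (forall s : nat -> nat, bijective s -> cvgn (series (u \o s))) ->
  exists M : R, forall t : nat -> R, (forall n, `|t n| <= 1) ->
  forall N, `|\sum_(0 <= n < N) t n *: u n| <= M.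
Proof.
move=> uu.
suff [M HM] : exists M : R, forall (b : nat -> bool) N, `|\sum_(0 <= n < N | b n) u n| <= M.
  by exists (2 * M); exact: multiplier_bound.
apply: contrapT => /forallNP unb.
have big N : exists p : nat * (nat -> bool), (N < p.1)%N /\
    1 <= `|\sum_(N <= n < p.1 | p.2 n) u n|.
  apply: contrapT => /forallNP small.
  apply: (unb (\sum_(0 <= n < N) `|u n| + 1)) => b N'.
  have head K : (K <= N)%N -> `|\sum_(0 <= n < K | b n) u n| <= \sum_(0 <= n < N) `|u n|.
    move=> KN; apply: le_trans (ler_norm_sum _ _ _) _.
    rewrite (big_cat_nat (leq0n K) KN)//= big_mkcond/= -[leLHS]addr0 lerD//.
      by apply: ler_sum => n _; case: ifP.
    by rewrite sumr_ge0.
  have [N'N|NN'] := leqP N' N.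
    by rewrite (le_trans (head _ N'N))// lerDl.
  rewrite (big_cat_nat (leq0n N) (ltnW NN'))//=.
  apply: le_trans (ler_normD _ _) _; rewrite lerD ?head//.
  have := small (N', b); rewrite leNgt => /not_andP[//|/negP]; rewrite negbK; exact: ltW.
have /choice[f Hf] := big.
pose nx N := (f N).1; pose mk N := (f N).2.
have nx_gt N : (N < nx N)%N by case: (Hf N).
have := uu _ (block_perm_bij mk nx_gt) => /cvg_cauchy/cauchy_seriesP/(_ 1 ltr01).
move=> [[A B] /= [[n1 _ An1] [n2 _ Bn2]] AB].
pose k := maxn n1 n2; pose Nk := iter k nx 0%N.
have kN : (k <= Nk)%N.
  by rewrite /Nk; elim: (k) => // j /leq_ltn_trans; apply; rewrite iterS.
have [M] := block_perm_series mk nx_gt u k; rewrite -/Nk.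
have [_ +] := Hf Nk; rewrite -/(nx Nk) -/(mk Nk) => big1 EM.
have /(AB (Nk, Nk + M)%N) : (A `*` B) (Nk, (Nk + M)%N).
  split; [apply: An1|apply: Bn2] => /=.
    by rewrite (leq_trans _ kN)// leq_maxl.
  by rewrite (leq_trans _ (leq_addr _ _))// (leq_trans _ kN)// leq_maxr.
rewrite /= ltNge => /negP; apply; move: big1; rewrite -EM.
by rewrite (big_cat_nat (leq0n Nk) (leq_addr _ _))//= [X in `|X - _|]addrC addrK.
Qed.

End BoundedMultipliers.

Section Coordinates.
Variables (R : realType) (X : completeNormedModType R) (e : nat -> X).
Variable a : X -> nat -> R.
Hypothesis a_cvg : forall x, series (fun n => a x n *: e n) @ \oo --> x.
Hypothesis a_uniq : forall x b, series (fun n => b n *: e n) @ \oo --> x -> b = a x.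
Hypothesis a_bounded : forall x, exists M : R, forall t : nat -> R,
  (forall n, `|t n| <= 1) -> forall N, `|\sum_(0 <= n < N) t n *: (a x n *: e n)| <= M.

Let bounded_by (x : X) (M : R) := forall t : nat -> R, (forall n, `|t n| <= 1) ->
  forall N, `|\sum_(0 <= n < N) (t n * a x n) *: e n| <= M.

Lemma coordinate_linear c x y n : a (c *: x + y) n = c * a x n + a y n.
Proof.
rewrite -(_ : (fun n => c * a x n + a y n) = a (c *: x + y))//; apply: a_uniq.
rewrite (_ : series _ = fun N => c *: series (fun n => a x n *: e n) N +
  series (fun n => a y n *: e n) N).
  by apply: cvgD; [apply: cvgZ; [exact: cvg_cst|exact: a_cvg]|exact: a_cvg].
apply/funext => N; rewrite /series/= scaler_sumr -big_split/=.
by apply: eq_bigr => k _; rewrite scalerDl scalerA.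
Qed.

Let a0 n : a 0 n = 0.
Proof. by have := coordinate_linear (-1) 0 0 n; rewrite scaler0 addr0 mulN1r addNr. Qed.

Let aD x y n : a (x + y) n = a x n + a y n.
Proof. by have := coordinate_linear 1 x y n; rewrite scale1r mul1r. Qed.

Let aZ c x n : a (c *: x) n = c * a x n.
Proof. by have := coordinate_linear c x 0 n; rewrite addr0 a0 addr0. Qed.

Let bounded_by0 : bounded_by 0 0.
Proof. by move=> t t1 N; rewrite big1 ?normr0// => n _; rewrite a0 mulr0 scale0r. Qed.

Let bounded_byD x y M M' : bounded_by x M -> bounded_by y M' -> bounded_by (x + y) (M + M').
Proof.
move=> xM yM t t1 N.
have -> : \sum_(0 <= n < N) (t n * a (x + y) n) *: e n =
  \sum_(0 <= n < N) (t n * a x n) *: e n + \sum_(0 <= n < N) (t n * a y n) *: e n.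
  by rewrite -big_split; apply: eq_bigr => n _; rewrite aD mulrDr scalerDl.
by apply: le_trans (ler_normD _ _) _; rewrite lerD ?xM ?yM.
Qed.

Let bounded_byZ c x M : bounded_by x M -> bounded_by (c *: x) (`|c| * M).
Proof.
move=> xM t t1 N.
have -> : \sum_(0 <= n < N) (t n * a (c *: x) n) *: e n =
  c *: \sum_(0 <= n < N) (t n * a x n) *: e n.
  by rewrite scaler_sumr; apply: eq_bigr => n _; rewrite aZ scalerA mulrCA.
by rewrite normrZ ler_wpM2l// xM.
Qed.

(** The vectors whose multiplier sums are bounded by [m] exhaust the space, so by
    the category theorem the closure of one of these convex symmetric sets has
    interior: every vector is a limit of vectors with comparably bounded sums. *)
Lemma bounded_by_dense : exists2 C : R, 0 <= C &
  forall h (eps : R), 0 < eps -> exists2 w, `|h - w| < eps & bounded_by w (C * `|h|).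
Proof.
pose A (m : nat) := [set x | bounded_by x m%:R].
pose F m := ~` closure (A m).
have oF m : open (F m) by apply: closed_openC; exact: closed_closure.
have : ~ (forall m, dense (F m)).
  move=> dF; have dB : dense (\bigcap_i F i) by apply: Baire => m; split.
  have [x [_ Fx]] := dB setT (ex_intro _ 0 I) openT.
  have [M HM] := a_bounded x.
  have M0 : 0 <= M by apply: le_trans (HM (fun=> 0) _ 0%N) => // n; rewrite normr0.
  apply: (Fx (Num.truncn M).+1) => //; apply: subset_closure => t t1 N.
  apply: (@le_trans _ _ M); last by rewrite ltW// truncnS_gt.
  by rewrite (eq_bigr (fun n => t n *: (a x n *: e n))) ?HM// => n _; rewrite scalerA.
move=> /existsNP[m /existsNP[U /not_implyP[U0 /not_implyP[oU /nonemptyPn UF]]]].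
have [x0 Ux0] := U0.
have /nbhs_normP[r r0 rU] : nbhs x0 U by apply: open_nbhs_nbhs.
have clA y : `|x0 - y| < r -> closure (A m) y.
  move=> yr; apply: contrapT => nA; suff : (U `&` F m) y by rewrite UF.
  by split=> //; exact: rU.
have appr y eps : `|x0 - y| < r -> 0 < eps -> exists2 w, `|y - w| < eps & bounded_by w m%:R.
  move=> /clA cy e0; have [w [Aw yw]] : A m `&` [set w | `|y - w| < eps] !=set0.
    by apply: cy; apply/nbhs_normP; exists eps.
  by exists w.
have r20 : 0 < r / 2 by rewrite divr_gt0.
have r2r : r / 2 < r by rewrite ltr_pdivrMr// ltr_pMr// ltr1n.
exists (2 * m%:R / (r / 2)) => [|h eps eps0].
  by rewrite divr_ge0 ?mulr_ge0// ltW.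
have [->|h0] := eqVneq h 0.
  by exists 0; rewrite ?subrr ?normr0 ?mulr0.
have nh : 0 < `|h| by rewrite normr_gt0.
pose c := (r / 2) / `|h|; have c0 : 0 < c by rewrite divr_gt0.
have e0 : 0 < c * eps / 2 by rewrite divr_gt0// mulr_gt0.
have [|w1 hw1 bw1] := appr (x0 + c *: h) (c * eps / 2) _ e0.
  rewrite opprD addNKr normrN normrZ gtr0_norm// /c divfK//.
  by rewrite gt_eqF.
have [|w2 hw2 bw2] := appr x0 (c * eps / 2) _ e0.
  by rewrite subrr normr0.
exists (c^-1 *: (w1 - w2)).
  have -> : h - c^-1 *: (w1 - w2) = c^-1 *: ((x0 + c *: h - w1) - (x0 - w2)).
    rewrite -{1}(scalerK (lt0r_neq0 c0) h) -scalerBr; congr (_ *: _).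
    by linear_identity R.
  rewrite normrZ gtr0_norm ?invr_gt0// ltr_pdivrMl//.
  by apply: le_lt_trans (ler_normB _ _) _; lra.
have -> : 2 * m%:R / (r / 2) * `|h| = `|c^-1| * (m%:R + `|-1| * m%:R).
  rewrite normrN1 mul1r gtr0_norm ?invr_gt0// /c; field.
  by rewrite !gt_eqF.
by apply: bounded_byZ; apply: bounded_byD => //; rewrite -scaleN1r; exact: bounded_byZ.
Qed.

Lemma basis_neq0 n : e n != 0.
Proof.
apply/eqP => en0; suff E : (fun k : nat => (k == n)%:R) = a 0.
  by have /eqP := congr1 (@^~ n) E; rewrite a0 eqxx oner_eq0.
apply: a_uniq; rewrite (_ : series _ = fun=> 0); first exact: cvg_cst.
apply/funext => N; rewrite /series/= big1// => k _.
by case: eqP => [->|]; rewrite ?en0 ?scaler0 ?scale0r.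
Qed.

Lemma coordinate_basis i j : a (e j) i = (i == j)%:R.
Proof.
suff E : (fun k : nat => (k == j)%:R) = a (e j) by rewrite -E.
apply: a_uniq; apply: (@cvg_near_cst _ _ _ _ _ _ _).
exists j.+1 => // N /= jN; rewrite /series/= big_mkord (bigD1 (Ordinal jN))//=.
rewrite eqxx scale1r big1 ?addr0// => k; rewrite -val_eqE/= => /negPf ->.
by rewrite scale0r.
Qed.

(** The approximation of [bounded_by_dense] is iterated on the remainders, as in
    the proof of the open mapping theorem; uniqueness of the expansion identifies
    the sum of the coordinates of the approximants. *)
Lemma multipliers_bounded : exists2 C : R, 0 <= C & forall x, bounded_by x (C * `|x|).
Proof.
have [C C0 dense] := bounded_by_dense.
exists (2 * C) => [|x]; first by rewrite mulr_ge0.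
have [->|x0] := eqVneq x 0; first by rewrite normr0 mulr0.
have nx : 0 < `|x| by rewrite normr_gt0.
have h0 k : 0 < 2^-1 ^+ k :> R by rewrite exprn_gt0// invr_gt0.
have /choice[W HW] (p : X * nat) : exists w,
    `|p.1 - w| < `|x| * 2^-1 ^+ p.2.+1 /\ bounded_by w (C * `|p.1|).
  have [w] := dense p.1 (`|x| * 2^-1 ^+ p.2.+1) (mulr_gt0 nx (h0 _)).
  by exists w.
(* [r k] is the remainder after [k] approximations, [s k] their sum. *)
pose fix r k := if k is j.+1 then r j - W (r j, j) else x.
pose w k := W (r k, k).
have rS k : r k.+1 = r k - w k by [].
have rle k : `|r k| <= `|x| * 2^-1 ^+ k.
  case: k => [|k]; first by rewrite expr0 mulr1.
  by rewrite rS ltW//; case: (HW (r k, k)).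
have bw k : bounded_by (w k) (C * `|x| * 2^-1 ^+ k).
  move=> t t1 N; have [_ /(_ t t1 N)] := HW (r k, k).
  by move=> /le_trans; apply; rewrite -mulrA; apply: ler_wpM2l => //; exact: rle.
pose s K := x - r K.
have sS K : s K.+1 = s K + w K by rewrite /s rS; linear_identity R.
have s0 : s 0%N = 0 by rewrite /s subrr.
have bs K k : bounded_by (s (K + k)%N - s K) (2 * (C * `|x|) * (2^-1 ^+ K - 2^-1 ^+ (K + k))).
  elim: k => [|k IH]; first by rewrite addn0 !subrr mulr0.
  rewrite addnS sS (_ : s _ + _ - _ = (s (K + k)%N - s K) + w (K + k)%N); last by linear_identity R.
  rewrite (_ : 2 * _ * _ = 2 * (C * `|x|) * (2^-1 ^+ K - 2^-1 ^+ (K + k)) +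
     C * `|x| * 2^-1 ^+ (K + k)); last by rewrite exprS; field.
  exact: bounded_byD.
have bs' K K' : (K <= K')%N -> bounded_by (s K' - s K) (2 * (C * `|x|) * 2^-1 ^+ K).
  move=> /subnKC <- t t1 N; apply: le_trans (bs _ _ _ t1 _) _.
  by apply: ler_wpM2l; [rewrite !mulr_ge0|rewrite gerBl; exact: ltW].
have conv n : exists l : R^o, (fun K => a (s K) n : R^o) @ \oo --> l.
  have nen : 0 < `|e n| by rewrite normr_gt0 basis_neq0.
  suff cl : cvgn (fun K => a (s K) n : R^o) by exists (limn (fun K => a (s K) n : R^o)).
  suff : forall m, `|(a (s m.+1) n : R^o) - a (s m) n| <= C * `|x| / `|e n| * 2^-1 ^+ m.
    by move=> /(@geometric_cvgn _ R^o (fun K => a (s K) n))[].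
  move=> m.
  rewrite sS aD addrC addKr.
  rewrite mulrAC ler_pdivlMr//.
  have := bw m (fun k => (k == n)%:R) _ n.+1.
  rewrite big_nat_recr//= big_nat big1 ?add0r ?eqxx ?mul1r.
    by rewrite normrZ; apply => k; case: eqP; rewrite ?normr1 ?normr0.
  by move=> k /andP[_ kn]; rewrite (ltn_eqF kn) mul0r scale0r.
have [al Hal] := choice conv.
have lim K (t : nat -> R) N : (forall n, `|t n| <= 1) ->
    `|\sum_(0 <= n < N) (t n * (al n - a (s K) n)) *: e n| <= 2 * (C * `|x|) * 2^-1 ^+ K.
  move=> t1.
  have cv : \sum_(0 <= n < N) (t n * (a (s K') n - a (s K) n)) *: e n @[K' --> \oo] -->
      \sum_(0 <= n < N) (t n * (al n - a (s K) n)) *: e n.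
    elim: N => [|N IH].
      rewrite big_geq//; under eq_fun do rewrite big_geq//; exact: cvg_cst.
    rewrite big_nat_recr//=; under eq_fun do rewrite big_nat_recr//=.
    apply: cvgD => //; apply: cvgZ; last exact: cvg_cst.
    apply: cvgM; first exact: cvg_cst.
    by apply: cvgB; [exact: Hal|exact: cvg_cst].
  rewrite -[X in `|X|]subr0; apply: (norm_lim_le (N := K) cv) => K' KK'.
  have := bs' _ _ KK' t t1 N; rewrite subr0.
  rewrite (eq_bigr (fun n => (t n * (a (s K') n - a (s K) n)) *: e n))// => n _.
  by rewrite aD -scaleN1r aZ mulN1r.
(* The limits [al] of the coordinates of [s K] are the coordinates of an expansion
   of [x], up to an error that is uniform in the length of the partial sum. *)
have xal : al = a x.
  apply: a_uniq; apply/cvgrPdist_lt => /= eps eps0.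
  have [K HK] := half_pow_lt (2 * (2 * (C * `|x|) + `|x|)) eps0.
  have {}HK := HK K (leqnn K).
  have e2 : 0 < eps / 2 by rewrite divr_gt0.
  have /cvgrPdist_lt/(_ _ e2) := @a_cvg (s K).
  apply: filterS => N HN.
  have one_le (n : nat) : `|1 : R| <= 1 by rewrite normr1.
  have L1 := lim K (fun=> 1) N one_le; have L2 := rle K; clear one_le.
  have -> : x - series (fun n => al n *: e n) N =
     - \sum_(0 <= n < N) (1 * (al n - a (s K) n)) *: e n +
     (s K - series (fun n => a (s K) n *: e n) N) + r K.
    have -> : \sum_(0 <= n < N) (1 * (al n - a (s K) n)) *: e n =
       series (fun n => al n *: e n) N - series (fun n => a (s K) n *: e n) N.
      by rewrite /series/= -sumrB; apply: eq_bigr => n _; rewrite mul1r scalerBl.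
    by rewrite /s; linear_identity R.
  apply: le_lt_trans (ler_normD _ _) _.
  apply: le_lt_trans (lerD (ler_normD _ _) (lexx _)) _.
  by rewrite normrN; lra.
move=> t t1 N; have := lim 0%N t N t1.
rewrite expr0 mulr1 mulrA s0 xal.
by under eq_bigr do rewrite a0 subr0.
Qed.

End Coordinates.

Lemma unconditional_coordinates (R : realType) (X : completeNormedModType R) (e : nat -> X) :
  unconditional_basis e -> exists (a : nat -> clin X R^o) (C : R),
  [/\ 1 <= C, forall x, series (fun n => a n x *: e n) @ \oo --> x,
      forall i j, a i (e j) = (i == j)%:R &
      forall x (t : nat -> R), (forall n, `|t n| <= 1) -> forall N,
        `|\sum_(0 <= n < N) (t n * a n x) *: e n| <= C * `|x|].
Proof.
move=> [be ue].
have ex (x : X) : exists a : nat -> R, series (fun n => a n *: e n) @ \oo --> x /\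
    forall b, series (fun n => b n *: e n) @ \oo --> x -> b = a.
  by have [a [ax au]] := be x; exists a; split=> // b /au.
have [a Ha] := choice ex.
have a_cvg x := (Ha x).1; have a_uniq x := (Ha x).2.
have a_bd x : exists M : R, forall t : nat -> R,
  (forall n, `|t n| <= 1) -> forall N, `|\sum_(0 <= n < N) t n *: (a x n *: e n)| <= M.
  by apply: unconditional_bounded; apply: ue; apply/cvg_ex; exists x.
have [C C0 HC] := multipliers_bounded a_cvg a_uniq a_bd.
have lin n : linear (fun x => a x n : R^o).
  by move=> c x y; exact: coordinate_linear.
have bd n : exists M, forall x, `|a x n : R^o| <= M * `|x|.
  have en := basis_neq0 a_cvg a_uniq n.
  exists (C / `|e n|) => x; rewrite mulrAC ler_pdivlMr ?normr_gt0//.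
  have := HC x (fun k => (k == n)%:R) _ n.+1.
  rewrite big_nat_recr//= big_nat big1 ?add0r ?eqxx ?mul1r.
    by rewrite normrZ; apply => k; case: eqP; rewrite ?normr1 ?normr0.
  by move=> k /andP[_ kn]; rewrite (ltn_eqF kn) mul0r scale0r.
exists (fun n => mkclin (lin n) (bd n)), (C + 1); split.
- by rewrite lerDr.
- exact: a_cvg.
- by move=> i j /=; exact: (coordinate_basis a_uniq).
- move=> x t t1 N; apply: le_trans (HC x t t1 N) _.
  by rewrite ler_wpM2r// lerDl.
Qed.

(** * Retracting locally onto finite dimensional subspaces *)

Section Cutoff.
Variable R : realType.

(** A Lipschitz substitute for the indicator function of the unit ball. *)
Record cutoff (X : normedModType R) (L : R) (phi : X -> R^o) : Prop := Cutoff {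
  cutoff_Lip : Lip L phi;
  cutoff_itv : forall x, 0 <= phi x <= 1;
  cutoff_one : exists2 del : R, 0 < del & forall x, `|x| <= del -> phi x = 1;
  cutoff_zero : forall x, 1 <= `|x| -> phi x = 0 }.

Lemma Ck_id n (X : normedModType R) : Ck n (fun x : X => x).
Proof.
have lin : linear (fun x : X => x) by [].
have bd : exists M : R, forall x : X, `|x| <= M * `|x| by exists 1 => x; rewrite mul1r.
exact: (Ck_clin n (mkclin lin bd)).
Qed.

Lemma CkB n (X Z : normedModType R) (f g : X -> Z) :
  Ck n f -> Ck n g -> Ck n (fun x => f x - g x).
Proof.
move=> cf cg; rewrite (_ : (fun x => _) = fun x => f x + (-1 : R^o) *: g x).
  by apply: CkD => //; apply: CkZ => //; exact: Ck_cst.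
by apply/funext => x; linear_identity R.
Qed.

End Cutoff.

Section Retraction.
Variables (R : realType) (X : completeNormedModType R) (e : nat -> X).
Variables (a : nat -> clin X R^o) (C : R).
Hypothesis C1 : 1 <= C.
Hypothesis a_cvg : forall x, series (fun n => a n x *: e n) @ \oo --> x.
Hypothesis a_basis : forall i j, a i (e j) = (i == j)%:R.
Hypothesis a_mult : forall x (t : nat -> R), (forall n, `|t n| <= 1) -> forall N,
  `|\sum_(0 <= n < N) (t n * a n x) *: e n| <= C * `|x|.

Let C0 : 0 <= C. Proof. exact: le_trans C1. Qed.

Definition head n x := \sum_(i < n) a i x *: e i.
Definition tail n x := x - head n x.

Lemma multiplier_le x (t : nat -> R) c N : (forall n, `|t n| <= c) ->
  `|\sum_(i < N) (t i * a i x) *: e i| <= C * (c * `|x|).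
Proof.
move=> tc; have c0 : 0 <= c by apply: le_trans (tc 0%N).
have [c0'|cn0] := eqVneq c 0.
  rewrite c0' mul0r mulr0 big1 ?normr0// => i _.
  by have := tc i; rewrite c0' normr_le0 => /eqP ->; rewrite mul0r scale0r.
have cp : 0 < c by rewrite lt_def cn0.
have := a_mult x (t := fun n => t n / c) _ N; rewrite big_mkord.
have -> : \sum_(i < N) (t i * a i x) *: e i = c *: \sum_(i < N) (t i / c * a i x) *: e i.
  rewrite scaler_sumr; apply: eq_bigr => i _; rewrite scalerA; congr (_ *: _).
  by field.
move=> H; rewrite normrZ gtr0_norm// mulrCA ler_wpM2l//; apply: H => n.
by rewrite normrM normfV (gtr0_norm cp) ler_pdivrMr// mul1r.
Qed.

Lemma head_le n x : `|head n x| <= C * `|x|.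
Proof.
have := @multiplier_le x (fun=> 1) 1 n; rewrite mul1r.
under eq_bigr do rewrite mul1r.
by apply => _; rewrite normr1.
Qed.

Lemma headB n x y : head n (x - y) = head n x - head n y.
Proof.
rewrite /head -sumrB; apply: eq_bigr => i _.
by rewrite linearB/= scalerBl.
Qed.

Lemma tailB n x y : tail n (x - y) = tail n x - tail n y.
Proof. by rewrite /tail headB; linear_identity R. Qed.

Lemma tail_le n x : `|tail n x| <= (1 + C) * `|x|.
Proof.
apply: le_trans (ler_normB _ _) _; rewrite mulrDl mul1r lerD//.
exact: head_le.
Qed.

Lemma head_cvg x : head n x @[n --> \oo] --> x.
Proof.
have := @a_cvg x; rewrite (_ : series _ = fun n => head n x)//.
by apply/funext => n; rewrite /series/= big_mkord.
Qed.

Lemma coord_sum i (c : nat -> R) N :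
  a i (\sum_(j < N) c j *: e j) = if (i < N)%N then c i else 0.
Proof.
rewrite linear_sum/=.
under eq_bigr do rewrite linearZ/= a_basis.
case: ltnP => iN.
  rewrite (bigD1 (Ordinal iN))//= eqxx [_ *: _]mulr1 big1 ?addr0// => j.
  by rewrite -val_eqE/= eq_sym => /negPf ->; exact: mulr0.
rewrite big1// => j _; rewrite gtn_eqF ?[_ *: _]mulr0//.
exact: leq_trans (ltn_ord j) iN.
Qed.

Lemma coord_tail i n x : (n <= i)%N -> a i (tail n x) = a i x.
Proof.
by move=> ni; rewrite /tail linearB/= /head (coord_sum i (fun i => a i x)) ltnNge ni subr0.
Qed.

Lemma multiplier_tail_le x (t : nat -> R) c N n : (forall n, `|t n| <= c) ->
  (forall i, (i < n)%N -> t i = 0) ->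
  `|\sum_(i < N) (t i * a i x) *: e i| <= C * (c * `|tail n x|).
Proof.
move=> tc tn.
have -> : \sum_(i < N) (t i * a i x) *: e i = \sum_(i < N) (t i * a i (tail n x)) *: e i.
  apply: eq_bigr => i _; have [ni|/tn ->] := leqP n i; first by rewrite coord_tail.
  by rewrite !mul0r.
exact: multiplier_le.
Qed.

Section CutTails.
Variables (L : R) (phi : X -> R^o) (r : R).
Hypothesis cphi : cutoff L phi.
Hypothesis r0 : 0 < r.

Let L0 : 0 <= L * `|e 0|.
Proof.
have [H _ _ _] := cphi; have := H (e 0%N) 0; rewrite subr0.
exact: le_trans.
Qed.

(** How small the n-th tail is at the scale [r]: from 1 when it is negligible down to
    0 when its norm is at least [r]. *)
Definition small n x : R^o := phi (r^-1 *: tail n x).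

Definition retract_upto N x := \sum_(i < N) ((1 - small i x) * a i x) *: e i.

Let small_itv n x : 0 <= small n x <= 1. Proof. by case: cphi => _ H _ _; exact: H. Qed.

Lemma small_Lip n x y : `|small n x - small n y| <= L * (1 + C) / r * `|x - y|.
Proof.
have [H _ _ _] := cphi; apply: le_trans (H _ _) _.
have L_ge0 : 0 <= L.
  have e0 : 0 < `|e 0%N|.
    rewrite normr_gt0; apply/eqP => e00; have := a_basis 0 0.
    by rewrite e00 linear0 eqxx => /eqP; rewrite eq_sym oner_eq0.
  by rewrite -(pmulr_lge0 _ e0).
rewrite -scalerBr -tailB normrZ gtr0_norm ?invr_gt0// -!mulrA ler_wpM2l//.
by rewrite [leRHS]mulrCA; apply: ler_wpM2l; [rewrite invr_ge0 ltW|exact: tail_le].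
Qed.

Lemma small_neq0 n x : small n x != 0 -> `|tail n x| <= r.
Proof.
move=> H; rewrite leNgt; apply: contra H => rx; apply/eqP.
rewrite /small; have [_ _ _ ->//] := cphi.
by rewrite normrZ gtr0_norm ?invr_gt0// ler_pdivlMl// mulr1 ltW.
Qed.

(** The tails tend to zero, and uniformly near each point because they are
    equicontinuous. *)
Lemma small_eventually x : exists N, exists2 d : R, 0 < d &
  forall y, `|x - y| < d -> forall n, (N <= n)%N -> small n y = 1.
Proof.
have [_ _ [d d0 H] _] := cphi.
have d2 : 0 < r * d / 2 by rewrite divr_gt0// mulr_gt0.
have [N _ HN] : \forall n \near \oo, `|tail n x| < r * d / 2.
  by have /cvgrPdist_lt/(_ _ d2) := @head_cvg x.
have C1' : 0 < 1 + C by rewrite ltr_wpDr.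
exists N, (r * d / 2 / (1 + C)); first by rewrite divr_gt0.
move=> y xy n Nn; apply: H.
rewrite normrZ gtr0_norm ?invr_gt0// ler_pdivrMl//.
rewrite -[tail n y](subKr (tail n x)) -tailB; apply: le_trans (ler_normB _ _) _.
have := HN n Nn; have := tail_le n (x - y).
move: xy; rewrite ltr_pdivlMr// => xy /=; rewrite mulrC; lra.
Qed.

Lemma retract_upto_stable x N M : (forall n, (N <= n)%N -> small n x = 1) ->
  (N <= M)%N -> retract_upto M x = retract_upto N x.
Proof.
move=> H /subnK <-; elim: (M - N)%N => // j IH.
rewrite addSn /retract_upto big_ord_recr/= -/(retract_upto _ x) IH H ?leq_addl//.
by rewrite subrr mul0r scale0r addr0.
Qed.

Let rank x : {N | forall n, (N <= n)%N -> small n x = 1}.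
Proof.
apply: cid; have [N [d d0 H]] := small_eventually x; exists N.
by apply: H; rewrite subrr normr0.
Qed.

Definition retract x := retract_upto (sval (rank x)) x.

Lemma retractE x N : (forall n, (N <= n)%N -> small n x = 1) ->
  retract x = retract_upto N x.
Proof.
move=> H; rewrite /retract; case: (rank x) => M HM /=.
have [MN|/ltnW NM] := leqP M N; first by rewrite -(retract_upto_stable HM MN).
exact: retract_upto_stable.
Qed.

(** The first coordinate that is cut decides: from there on the tail is short. *)
Lemma retract_near x : `|retract x - x| <= C * r.
Proof.
have [N HN] := rank x.
have ex : exists n, small n x != 0 by exists N; rewrite HN// oner_eq0.
case: (ex_minnP ex) => n0 /small_neq0 tn0 n0min.
rewrite distrC; apply: (norm_lim_le (N := N) (@head_cvg x)) => M NM.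
rewrite (retractE HN) -(retract_upto_stable HN NM).
have -> : head M x - retract_upto M x = \sum_(i < M) (small i x * a i x) *: e i.
  rewrite /head /retract_upto -sumrB; apply: eq_bigr => i _.
  by rewrite -scalerBl; congr (_ *: _); ring.
apply: (le_trans (@multiplier_tail_le x (fun i => small i x) 1 M n0 _ _)).
- by move=> n; have /andP[h1 h2] := small_itv n x; rewrite ger0_norm.
- move=> i; apply: contraTeq => /n0min; by rewrite -leqNgt.
- by rewrite mul1r ler_wpM2l.
Qed.

(** Let [n0] be the first coordinate that is cut at [x] or [y], say at [x]. Moving the
    vector costs the norm of a multiplier. Moving the multiplier costs its slope, of
    order [1 / r], times the norm of the tail of [x] after [n0], at most [r]. *)
Lemma retract_Lip : Lip (C * (1 + L * (1 + C))) retract.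
Proof.
suff H x y n0 : `|tail n0 x| <= r ->
    (forall i, (i < n0)%N -> small i x = 0 /\ small i y = 0) ->
    `|retract y - retract x| <= C * (1 + L * (1 + C)) * `|y - x|.
  move=> x y; have [N HN] := rank x.
  have ex : exists n, (small n x != 0) || (small n y != 0).
    by exists N; rewrite HN// oner_eq0.
  case: (ex_minnP ex) => n0 n0P n0min.
  have z i : (i < n0)%N -> small i x = 0 /\ small i y = 0.
    move=> i0; have /contra := n0min i; rewrite -ltnNge => /(_ i0).
    by rewrite negb_or !negbK => /andP[/eqP -> /eqP ->].
  case/orP: n0P => /small_neq0 tn0; last exact: (H y x n0 tn0 (fun i h => conj (z i h).2 (z i h).1)).
  by rewrite distrC [`|x - y|]distrC; exact: (H x y n0 tn0).
move=> tn0 z.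
have [Nx HNx] := rank x; have [Ny HNy] := rank y.
pose N := maxn Nx Ny.
rewrite (@retractE x N); last by move=> n h; apply: HNx; rewrite (leq_trans _ h)// leq_maxl.
rewrite (@retractE y N); last by move=> n h; apply: HNy; rewrite (leq_trans _ h)// leq_maxr.
have -> : retract_upto N y - retract_upto N x =
  \sum_(i < N) ((1 - small i y) * a i (y - x)) *: e i +
  \sum_(i < N) ((small i x - small i y) * a i x) *: e i.
  rewrite -sumrB -big_split/=; apply: eq_bigr => i _.
  by rewrite -scalerBl -scalerDl linearB/=; congr (_ *: _); ring.
have B1 : `|\sum_(i < N) ((1 - small i y) * a i (y - x)) *: e i| <= C * (1 * `|y - x|).
  apply: (@multiplier_le _ (fun i => 1 - small i y)) => n.
  by have /andP[h1 h2] := small_itv n y; rewrite ger0_norm ?subr_ge0// gerBl.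
have B2 : `|\sum_(i < N) ((small i x - small i y) * a i x) *: e i| <=
    C * (L * (1 + C) / r * `|x - y| * `|tail n0 x|).
  apply: (@multiplier_tail_le _ (fun i => small i x - small i y)) => [n|i /z[-> ->]].
    exact: small_Lip.
  by rewrite subrr.
apply: le_trans (ler_normD _ _) _; apply: le_trans (lerD B1 B2) _.
rewrite mul1r -mulrDr -[leRHS]mulrA ler_wpM2l// mulrDl mul1r lerD//.
have D0 : 0 <= L * (1 + C) / r * `|x - y| by apply: le_trans (small_Lip 0 x y).
apply: le_trans (ler_wpM2l D0 tn0) _.
rewrite [`|x - y|]distrC le_eqVlt; apply/orP; left; apply/eqP; field.
by rewrite gt_eqF.
Qed.

Lemma retract_local (x : X) : exists N, \forall y \near x, retract y = retract_upto N y.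
Proof.
have [N [d d0 H]] := small_eventually x; exists N.
apply/nbhs_normP; exists d => // y /= xy; apply: retractE.
exact: H.
Qed.

Lemma Ck_retract_upto n N : Ck n phi -> Ck n (retract_upto N).
Proof.
move=> cf; apply: (@Ck_sum _ n _ _ N (fun i y => ((1 - small i y) * a i y) *: e i)) => i _.
apply: CkZ; last exact: Ck_cst.
apply: CkM; last exact: Ck_clin.
apply: CkB; first exact: Ck_cst.
rewrite /small; apply: (Ck_comp cf); apply: CkZ; first exact: Ck_cst.
apply: CkB; first exact: Ck_id.
apply: (@Ck_sum _ n _ _ i (fun i y => a i y *: e i)) => j _.
by apply: CkZ; [exact: Ck_clin|exact: Ck_cst].
Qed.

(** Near each point the retraction has values in the span of finitely many basis
    vectors, where the smoothed function is infinitely smooth. *)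
Lemma Ck_smoothed_retract n (Z : completeNormedModType R) (g : X -> Z) :
  Ck n phi -> smoothed e g -> Ck n (g \o retract).
Proof.
move=> cf sg; apply: Ck_local => x; have [N HN] := retract_local x.
exists ((fun z => g (\sum_(i < N) a i z *: e i)) \o retract_upto N).
  by apply: (Ck_comp (smoothed_Ck n a N sg)); exact: Ck_retract_upto.
apply: filterS HN => y /= ->; congr g; rewrite {1}/retract_upto.
apply: eq_bigr => i _.
by rewrite (coord_sum i (fun i => (1 - small i y) * a i y)) ltn_ord.
Qed.

End CutTails.

(** Smoothing keeps the Lipschitz constant, so all the loss comes from the retraction
    that is applied first; the error tends to zero with [r] and [rho]. *)
Lemma Lip_approximation (L : R) (phi : X -> R^o) (Z : completeNormedModType R)
    (f : X -> Z) (eta eps : R) :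
  cutoff L phi -> 0 <= eta -> Lip eta f -> 0 < eps ->
  exists K : X -> Z, [/\ forall n, Ck n phi -> Ck n K,
    Lip (C * (1 + L * (1 + C)) * eta) K & forall x, `|f x - K x| < eps].
Proof.
move=> cphi eta0 fL eps0.
have eta1 : 0 < eta + 1 by rewrite ltr_wpDl.
have Cp : 0 < C by exact: lt_le_trans C1.
pose r := eps / (4 * (eta + 1) * C); pose rho := eps / (8 * (eta + 1)).
have r0 : 0 < r by rewrite divr_gt0// !mulr_gt0.
have rho0 : 0 < rho by rewrite divr_gt0// !mulr_gt0.
have [d dr de] := recurrent_steps_exist e rho0.
pose g := smoothing d f.
have gL : Lip eta g by exact: smoothing_Lip dr.
exists (g \o retract cphi r0); split.
- by move=> n cn; apply: Ck_smoothed_retract => //; exists f, d, eta, rho.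
- move=> x y; apply: le_trans (gL _ _) _.
  by rewrite [leRHS]mulrAC mulrC ler_wpM2r// retract_Lip.
- move=> x; rewrite distrC /=.
  have H1 : `|g (retract cphi r0 x) - g x| <= eta * (C * r).
    by apply: le_trans (gL _ _) _; rewrite ler_wpM2l// retract_near.
  have H2 : `|g x - f x| <= eta * (2 * rho).
    apply: (smoothing_near eta0 fL dr) => y yx.
    by apply: le_trans (fL _ _) _; rewrite ler_wpM2l.
  rewrite -(subrK (g x) (g _)) -addrA; apply: le_lt_trans (ler_normD _ _) _.
  apply: le_lt_trans (lerD H1 H2) _.
  have -> : eta * (C * r) + eta * (2 * rho) = eta * (eps / (2 * (eta + 1))).
    by rewrite /r /rho; field; rewrite !gt_eqF.
  rewrite mulrA ltr_pdivrMr ?mulr_gt0//; nra.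
Qed.

End Retraction.

(** * Lipschitz estimates *)

Section InfConvolution.
Variables (R : realType) (X : normedModType R).

(** The infimum over [y] of [f y + A * `|x - y|]; the term at [y = x] bounds it from
    above, and the hypothesis bounds it from below. *)
Lemma inf_convolution (Y : set X) (f : X -> R) (A del : R) : 0 <= A ->
  (forall x y, Y x -> Y y -> `|f x - f y| <= del + A * `|x - y|) ->
  exists2 F : X -> R^o, Lip A F & forall y, Y y -> `|F y - f y| <= del.
Proof.
move=> A0 fA; have [Y0|/set0P[y0 Yy0]] := eqVneq Y set0.
  exists (fun=> 0); last by move=> y; rewrite Y0.
  by move=> x y; rewrite subrr normr0 mulr_ge0.
pose S x := [set f y + A * `|x - y| | y in Y].
have S0 x : S x !=set0 by exists (f y0 + A * `|x - y0|), y0.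
have lbS x : has_lbound (S x).
  exists (f y0 - del - A * `|x - y0|) => _ [y Yy <-].
  have := fA _ _ Yy0 Yy; rewrite ler_norml => /andP[_ h].
  have : A * `|y0 - y| <= A * (`|x - y0| + `|x - y|).
    by rewrite ler_wpM2l// [`|x - y0|]distrC; exact: ler_distD.
  by rewrite mulrDr; lra.
have half x x' : inf (S x) <= inf (S x') + A * `|x - x'|.
  rewrite -lerBlDr; apply: lb_le_inf => // _ [y Yy <-].
  rewrite lerBlDr; apply: (@le_trans _ _ (f y + A * `|x - y|)).
    by apply: ge_inf => //; exists y.
  have : A * `|x - y| <= A * (`|x - x'| + `|x' - y|).
    by rewrite ler_wpM2l// ler_distD.
  by rewrite mulrDr; lra.
exists (fun x => inf (S x)).
  move=> x x'; rewrite ler_norml; have := half x x'; have := half x' x.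
  by rewrite [`|x' - x|]distrC => h1 h2; apply/andP; split; lra.
move=> y Yy; rewrite ler_norml; apply/andP; split.
  rewrite -lerBlDr opprK addrC; apply: lb_le_inf => // _ [y' Yy' <-].
  by have := fA _ _ Yy Yy'; rewrite ler_norml => /andP[_ h]; lra.
have del0 : 0 <= del.
  by have := fA _ _ Yy Yy; rewrite !subrr !normr0 mulr0 addr0.
have : inf (S y) <= f y + A * `|y - y| by apply: ge_inf => //; exists y.
by rewrite subrr normr0 mulr0; lra.
Qed.

Lemma lipschitz_extension (Y : set X) (f : X -> R) (A : R) : 0 <= A ->
  (forall x y, Y x -> Y y -> `|f x - f y| <= A * `|x - y|) ->
  exists2 F : X -> R^o, Lip A F & forall y, Y y -> F y = f y.
Proof.
move=> A0 fA; have [|F FA Ff] := @inf_convolution Y f A 0 A0.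
  by move=> x y Yx Yy; rewrite add0r; exact: fA.
exists F => // y /Ff; rewrite normr_le0 subr_eq0 => /eqP; exact.
Qed.

End InfConvolution.

Section MeanValue.
Variables (R : realType) (X Z : normedModType R).

(** Were the increment over a segment too large, bisection would produce nested
    segments with the same defect, contradicting the differentiability at their
    common point. *)
Lemma mean_value (u : X -> Z) (D : X -> clin X Z) (M : R) x y :
  (forall t : R, 0 <= t <= 1 -> has_frechet u (x + t *: (y - x)) (D (x + t *: (y - x)))) ->
  (forall t : R, 0 <= t <= 1 -> `|D (x + t *: (y - x))| <= M) ->
  `|u y - u x| <= M * `|y - x|.
Proof.
move=> uD DM; apply/ler_addgt0Pr => eps0' eps'0.
have [->|xy] := eqVneq y x; first by rewrite !subrr !normr0 mulr0 add0r ltW.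
have nd : 0 < `|y - x| by rewrite normr_gt0 subr_eq0.
pose eps := eps0' / `|y - x|; have eps0 : 0 < eps by rewrite divr_gt0.
have -> : M * `|y - x| + eps0' = (M + eps) * `|y - x|.
  by rewrite mulrDl /eps divfK// gt_eqF.
rewrite leNgt; apply/negP => bad.
pose h k : R := 2^-1 ^+ k.
pose p (t : R) := x + t *: (y - x).
(* [isbad k t]: the increment is too large on the segment of parameters from [t] to
   [t + h k]; [next] keeps a bad half of a bad segment. *)
pose isbad k t := (M + eps) * (h k * `|y - x|) < `|u (p (t + h k)) - u (p t)|.
pose next k t := if `[< isbad k.+1 t >] then t else t + h k.+1.
pose fix T k := if k is j.+1 then next j (T j) else 0.
have h0 k : 0 < h k by rewrite exprn_gt0// invr_gt0.
have hS k : h k = h k.+1 + h k.+1 by rewrite /h exprS; field.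
have Tbad k : isbad k (T k).
  elim: k => [|k IH].
    rewrite /isbad /= /h expr0 mul1r add0r /p scale0r scale1r addr0.
    by rewrite (addrC x) subrK.
  rewrite /= /next; case: asboolP => // /negP; rewrite -leNgt => ok.
  rewrite /isbad ltNge; apply/negP => ok2; move: IH; rewrite /isbad hS.
  apply/negP; rewrite -leNgt addrA.
  rewrite -(subrK (u (p (T k + h k.+1))) (u (p (T k + h k.+1 + h k.+1)))) -addrA.
  by apply: le_trans (ler_normD _ _) _; rewrite [(h _ + _) * _]mulrDl mulrDr lerD.
have Tstep k : T k <= T k.+1 <= T k + h k.+1.
  by have := h0 k.+1; rewrite /= /next; case: asboolP => _ hk; apply/andP; split; lra.
have [cT HT] : cvgn (T : nat -> R^o) /\
    forall m, `|limn (T : nat -> R^o) - T m| <= 2 * 1 * 2^-1 ^+ m.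
  apply: (@geometric_cvgn _ R^o) => m; have /andP[l1 l2] := Tstep m.
  by rewrite mul1r ger0_norm ?subr_ge0// -/(h m) hS; have := h0 m.+1; lra.
pose t := limn (T : nat -> R^o).
have Tmono k m : T k <= T (k + m)%N <= T k + (h k - h (k + m)%N).
  elim: m => [|m /andP[l1 l2]]; first by rewrite !addn0; apply/andP; split; lra.
  have /andP[l3 l4] := Tstep (k + m)%N; rewrite addnS.
  by move: (hS (k + m)%N) => e; apply/andP; split; lra.
have Tt k : T k <= t <= T k + h k.
  have H : \forall m \near \oo, T k <= T m <= T k + h k.
    exists k => // m /= /subnKC <-; have /andP[-> l2] := Tmono k (m - k)%N.
    by have := h0 (k + (m - k))%N; lra.
  apply/andP; split.
    by apply: limr_ge => //; apply: filterS H => m /andP[].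
  by apply: limr_le => //; apply: filterS H => m /andP[].
have t01 : 0 <= t <= 1 by have := Tt 0%N; rewrite /= add0r /h expr0.
have [d d0 Hd] := uD t t01 _ eps0.
have near_t s : `|s| * `|y - x| < d ->
    `|u (p (t + s)) - u (p t)| <= (M + eps) * (`|s| * `|y - x|).
  move=> sd; have E : p (t + s) = p t + s *: (y - x) by rewrite /p; linear_identity R.
  have := Hd (s *: (y - x)); rewrite -/(p t) -E normrZ => /(_ sd) H.
  rewrite -(subrK (D (p t) (s *: (y - x))) (u (p (t + s)) - u (p t))).
  apply: le_trans (ler_normD _ _) _; rewrite addrC mulrDl lerD//.
  apply: le_trans (clin_normP _ _) _; rewrite normrZ.
  by apply: ler_wpM2r; [rewrite mulr_ge0|exact: DM].
have [k /(_ k (leqnn k)) hk] := half_pow_lt `|y - x| d0.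
have /andP[l1 l2] := Tt k.
have s1 : `|T k - t| * `|y - x| < d.
  apply: le_lt_trans hk; rewrite mulrC ler_wpM2l// distrC ger0_norm ?subr_ge0//.
  by rewrite -/(h k); lra.
have s2 : `|T k + h k - t| * `|y - x| < d.
  apply: le_lt_trans hk; rewrite mulrC ler_wpM2l// ger0_norm ?subr_ge0//.
  by rewrite -/(h k); lra.
have := Tbad k; rewrite /isbad ltNge => /negP; apply.
have := near_t _ s1; have := near_t _ s2; rewrite !(addrC t) !subrK => H2 H1.
have -> : u (p (T k + h k)) - u (p (T k)) =
  (u (p (T k + h k)) - u (p t)) - (u (p (T k)) - u (p t)) by linear_identity R.
apply: le_trans (ler_normB _ _) _; apply: le_trans (lerD H2 H1) _.
rewrite -mulrDr -mulrDl ger0_norm ?subr_ge0// [`|T k - t|]distrC ger0_norm ?subr_ge0//.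
by rewrite (_ : T k + h k - t + (t - T k) = h k)//; ring.
Qed.

End MeanValue.

Section LocalAffine.
Variables (R : realType) (X Z : normedModType R).

(** The difference with the derivative at [x] has a small derivative near [x]. *)
Lemma C1_locally_affine (f : X -> Z) (kappa : R) (x : X) : 0 < kappa -> Ck 1 f ->
  exists2 s : R, 0 < s & exists T : clin X Z, forall y z, `|x - y| < s -> `|x - z| < s ->
    `|(f y - T y) - (f z - T z)| <= kappa * `|y - z|.
Proof.
move=> k0 [df cf]; have := cf x => /cvgrPdist_lt/(_ _ k0)/nbhs_normP[s /= s0 H].
exists s => //; exists (frechet f x) => y z ys zs.
have conv (t : R) : 0 <= t <= 1 -> `|x - (z + t *: (y - z))| < s.
  move=> /andP[t0 t1].
  have -> : x - (z + t *: (y - z)) = (1 - t) *: (x - z) + t *: (x - y) by linear_identity R.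
  apply: le_lt_trans (ler_normD _ _) _; rewrite !normrZ (ger0_norm t0) ger0_norm ?subr_ge0//.
  move: ys zs; set A := `|x - y|; set B := `|x - z| => ys zs.
  have t1' : 0 <= 1 - t by rewrite subr_ge0.
  have [AB|/ltW BA] := leP A B.
    by have := mulr_ge0 t0 (eqbRL (subr_ge0 _ _) AB); lra.
  by have := mulr_ge0 t1' (eqbRL (subr_ge0 _ _) BA); lra.
apply: (@mean_value _ _ _ (fun y => f y - frechet f x y)
          (fun w => frechet f w + (- 1 : R) *: frechet f x)) => t t01; last first.
  by rewrite -normrN opprD scaleN1r opprK addrC; apply/ltW/(H _ (conv _ t01)).
rewrite (_ : (fun y => _) = fun y => f y + ((- 1 : R) *: frechet f x) y); last first.
  by apply/funext => w; rewrite clinZ; linear_identity R.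
apply: has_frechetD; first exact: frechet_has.
exact: has_frechet_clin.
Qed.

End LocalAffine.

(** * Fine approximation and gluing *)

Section BumpCutoff.
Variables (R : realType) (X : normedModType R).

Lemma Cp_smooth_transfer p (Z W : normedModType R) (f : X -> Z) (g : X -> W) :
  (forall n, Ck n f -> Ck n g) -> Cp_smooth p f -> Cp_smooth p g.
Proof. by move=> fg; case: p => [n|] /=; [exact: fg|move=> cf n; exact: fg]. Qed.

Lemma Cp_smooth_C1 p (Z : normedModType R) (f : X -> Z) :
  p != Some 0%N -> Cp_smooth p f -> Ck 1 f.
Proof. by case: p => [[|n]|] // _; exact: Ck_le. Qed.

Lemma lipschitz_Lip (Z : normedModType R) (f : X -> Z) :
  lipschitz f -> exists2 L : R, 0 < L & Lip L f.
Proof.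
move=> /pinfty_ex_gt0[L L0 fL]; exists L => // x y.
by apply: (fL (x, y)).
Qed.

(** A bump, normalized to the value 1 at the origin and to support in the unit
    ball, becomes a cutoff after composition with a smooth step. *)
Lemma bump_cutoff p : has_lipschitz_bump p X ->
  exists L phi, [/\ 0 <= L, @cutoff R X L phi & Cp_smooth p phi].
Proof.
move=> [b [cb bs bn] /lipschitz_Lip[M M0 bM]].
have [x0 bx0] : exists x, b x != 0.
  apply: contrapT => /forallNP H; case: bn => x.
  rewrite (_ : [set x | b x != 0] = set0) ?closure0//.
  by apply/seteqP; split => // y /= by0; apply: (H y).
have [rho rho0 brho] : exists2 rho : R, 0 < rho & forall x, b x != 0 -> `|x| <= rho.
  have [rho rho0 H] := pinfty_ex_gt0 bs; exists rho => // x bx.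
  by apply: H; exact: subset_closure.
have [theta [ck_theta theta_Lip theta01 theta0 theta1]] := smooth_step_exists R.
pose c := rho + `|x0| + 1; have c0 : 0 < c by rewrite ltr_wpDl// addr_ge0// ltW.
have nb : 0 < `|b x0| by rewrite normr_gt0.
pose psi (x : X) : R^o := (b x0)^-1 * b (x0 + c *: x).
pose phi := theta \o psi.
pose L := 4 * (M * c / `|b x0|).
have L'0 : 0 < M * c / `|b x0| by rewrite divr_gt0// mulr_gt0.
have psiL : Lip (M * c / `|b x0|) psi.
  move=> x y; rewrite /psi -mulrBr normrM normfV mulrC mulrAC ler_wpM2r ?invr_ge0//.
  apply: le_trans (bM _ _) _; rewrite -mulrA ler_wpM2l ?(ltW M0)//.
  have -> : x0 + c *: x - (x0 + c *: y) = c *: (x - y) by linear_identity R.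
  by rewrite normrZ gtr0_norm.
exists L, phi; split.
- by rewrite mulr_ge0// ltW.
- split.
  + move=> x y; apply: le_trans (theta_Lip _ _) _.
    by rewrite -mulrA ler_wpM2l.
  + by move=> x; exact: theta01.
  + exists (3 / 8 / (M * c / `|b x0|)) => [|x]; first by apply: divr_gt0 => //; rewrite divr_gt0.
    rewrite ler_pdivlMr// => xd; apply: theta1.
    have : `|psi x - psi 0| <= 3 / 8.
      by apply: le_trans (psiL _ _) _; rewrite subr0 mulrC.
    have -> : psi 0 = 1 by rewrite /psi scaler0 addr0 mulVf.
    by rewrite ler_norml => /andP[h _]; lra.
  + move=> x x1; apply: theta0; rewrite /psi.
    suff -> : b (x0 + c *: x) = 0 by rewrite mulr0 invr_ge0.
    have [//|/brho] := eqVneq (b (x0 + c *: x)) 0.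
    have : c <= c * `|x| by rewrite ler_peMr// ltW.
    have := lerB_normD (c *: x) x0; rewrite normrZ gtr0_norm// [x0 + _]addrC.
    have cE : c = rho + `|x0| + 1 by [].
    by move: (`|c *: x + x0|) => A h1 h2 h3; exfalso; lra.
- apply: (Cp_smooth_transfer _ cb) => n {}cb; apply: Ck_comp; first exact: ck_theta.
  apply: CkM; first exact: Ck_cst.
  apply: (Ck_comp cb); apply: CkD; first exact: Ck_cst.
  by apply: CkZ; [exact: Ck_cst|exact: Ck_id].
Qed.

End BumpCutoff.

Section Glue.
Variables (R : realType) (X : normedModType R).

Lemma Lip_mul (A B : R) (f g : X -> R^o) : Lip A f -> Lip B g ->
  (forall x, 0 <= f x <= 1) -> (forall x, 0 <= g x <= 1) ->
  Lip (A + B) (fun x => f x * g x : R^o).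
Proof.
move=> fA gB f01 g01 x y.
have -> : f x * g x - f y * g y = (f x - f y) * g x + f y * (g x - g y) by ring.
apply: le_trans (ler_normD _ _) _; rewrite !normrM mulrDl.
have /andP[f0 f1] := f01 y; have /andP[g0 g1] := g01 x.
rewrite (ger0_norm f0) (ger0_norm g0); apply: lerD.
  by apply: le_trans (fA x y); rewrite ler_piMr.
by apply: le_trans (gB x y); rewrite ler_piMl.
Qed.

(* [sm] selects the orders of smoothness that the result inherits. *)
Variables (f : X -> R^o) (h : nat -> X -> R^o) (sm : nat -> Prop).
Hypothesis h_itv : forall j x, 0 <= h j x <= 1.
Hypothesis h_Lip : forall j, exists2 M : R, 0 <= M & Lip M (h j).
Hypothesis h_Ck : forall j n, sm n -> Ck n (h j).
Hypothesis h_cover : forall x, exists j, \forall y \near (x : X), h j y = 1.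
Hypothesis pieces : forall j (eps : R), 0 < eps -> exists l : X -> R^o,
  [/\ forall n, sm n -> Ck n l, forall x, h j x != 0 -> `|l x - f x| <= eps &
      forall x y, h j x != 0 -> h j y != 0 ->
        `|(l x - f x) - (l y - f y)| <= 2^-1 * `|x - y|].

(** Telescoping partition of unity: the remainder vanishes after the first index
    [i] at which [h i] equals 1, which makes the sums finite near each point. *)
Fixpoint remainder j x : R^o :=
  if j is i.+1 then remainder i x * (1 - h i x) else 1.

Definition partition j x : R^o := remainder j x * h j x.

Let compl_itv j x : 0 <= 1 - h j x <= 1.
Proof. by have := h_itv j x; lra. Qed.

Let remainder_itv j x : 0 <= remainder j x <= 1.
Proof.
elim: j => [|j /andP[r0 r1]] /=; first by rewrite ler01 lexx.
have /andP[c0 c1] := compl_itv j x; rewrite mulr_ge0//=.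
exact: mulr_ile1.
Qed.

Let compl_Lip j (M : R) : Lip M (h j) -> Lip M (fun x => 1 - h j x : R^o).
Proof.
move=> hM x y; rewrite (_ : 1 - h j x - (1 - h j y) = h j y - h j x).
  by rewrite distrC; exact: hM.
ring.
Qed.

Let remainder_Lip j : exists2 M : R, 0 <= M & Lip M (remainder j).
Proof.
elim: j => [|j [M M0 HM]].
  by exists 0 => // x y; rewrite subrr normr0 mul0r.
have [M' M'0 HM'] := h_Lip j; exists (M + M'); first exact: addr_ge0.
exact: (Lip_mul HM (compl_Lip HM')).
Qed.

Let partition_Lip j : exists2 M : R, 0 <= M & Lip M (partition j).
Proof.
have [M M0 HM] := remainder_Lip j; have [M' M'0 HM'] := h_Lip j.
by exists (M + M'); [exact: addr_ge0|exact: Lip_mul].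
Qed.

Let partition_ge0 j x : 0 <= partition j x.
Proof.
by have /andP[r0 _] := remainder_itv j x; have /andP[h0 _] := h_itv j x; exact: mulr_ge0.
Qed.

Let partition_sum N x : \sum_(j < N) partition j x = 1 - remainder N x.
Proof.
elim: N => [|N IH]; first by rewrite big_ord0 subrr.
by rewrite big_ord_recr/= IH /partition; ring.
Qed.

Let remainder0 i N x : h i x = 1 -> (i < N)%N -> remainder N x = 0.
Proof.
move=> hi /subnK <-; elim: (N - i.+1)%N => [|k IH].
  by rewrite add0n /= hi subrr mulr0.
by rewrite addSn /= IH mul0r.
Qed.

Let partition0 i j x : h i x = 1 -> (i < j)%N -> partition j x = 0.
Proof. by move=> hi ij; rewrite /partition (remainder0 hi ij) mul0r. Qed.

Let partition_neq0 j x : partition j x != 0 -> h j x != 0.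
Proof. by apply: contra => /eqP h0; rewrite /partition h0 mulr0. Qed.

(** Each piece is taken so close to [f] that the slope of its weight costs little;
    the slopes of the pieces themselves are averaged by the weights. *)
Lemma glue : exists g : X -> R^o, [/\ Lip 1 (fun x => g x - f x : R^o),
  forall x, `|g x - f x| <= 8^-1 & forall n, sm n -> Ck n g].
Proof.
have exM (j : nat) : exists M : R, 0 <= M /\ Lip M (partition j).
  by have [M M0 HM] := partition_Lip j; exists M.
have [M HM] := choice exM.
pose eps j : R := 8^-1 * 2^-1 ^+ j / (1 + M j).
have hp j : 0 < 2^-1 ^+ j :> R by rewrite exprn_gt0// invr_gt0.
have M1 j : 0 < 1 + M j by have [M0 _] := HM j; rewrite ltr_pwDl.
have eps0 j : 0 < eps j by rewrite /eps divr_gt0// mulr_gt0// invr_gt0.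
have epsM j : M j * eps j <= 8^-1 * 2^-1 ^+ j.
  rewrite /eps mulrA ler_pdivrMr// mulrC; apply: ler_wpM2l.
    by rewrite mulr_ge0 ?invr_ge0// ltW.
  by rewrite lerDr.
have eps8 j : eps j <= 8^-1.
  have hj1 : 2^-1 ^+ j <= 1 :> R.
    by rewrite exprn_ile1 ?invr_ge0// invf_le1// ler1n.
  rewrite /eps ler_pdivrMr//; have [M0 _] := HM j.
  by have := hp j; nra.
have [l Hl] := choice (fun j => pieces j (eps0 j)).
have [I0 HI0] := choice h_cover.
pose gN N x : R^o := \sum_(j < N) partition j x * l j x.
have stable i N N' x : h i x = 1 -> (i < N)%N -> (N <= N')%N -> gN N' x = gN N x.
  move=> hi iN /subnK <-; elim: (N' - N)%N => [//|k IH].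
  rewrite addSn /gN big_ord_recr/= -/(gN _ x) IH (partition0 hi) ?mul0r ?addr0//.
  by rewrite (leq_trans iN)// leq_addl.
pose g x := gN (I0 x).+1 x.
have gE i N x : h i x = 1 -> (i < N)%N -> g x = gN N x.
  move=> hi iN; have hI := nbhs_singleton (HI0 x); rewrite /g.
  have [NI|/ltnW NI] := leqP N (I0 x).+1; first exact: stable hi iN NI.
  by apply/esym; exact: (stable _ _ _ _ hI).
pose v j x := l j x - f x.
have diffE i N x : h i x = 1 -> (i < N)%N -> g x - f x = \sum_(j < N) partition j x * v j x.
  move=> hi iN; rewrite (gE _ _ _ hi iN) /gN.
  have -> : f x = \sum_(j < N) partition j x * f x.
    by rewrite -mulr_suml partition_sum (remainder0 hi iN) subr0 mul1r.
  by rewrite -sumrB; apply: eq_bigr => j _; rewrite -mulrBr.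
exists g; split.
- move=> x y; have hx := nbhs_singleton (HI0 x); have hy := nbhs_singleton (HI0 y).
  pose N := (maxn (I0 x) (I0 y)).+1.
  rewrite (diffE _ N _ hx) ?ltnS ?leq_maxl// (diffE _ N _ hy) ?ltnS ?leq_maxr//.
  rewrite -sumrB mul1r; apply: le_trans (ler_norm_sum _ _ _) _.
  have term j : `|partition j x * v j x - partition j y * v j y| <=
      (partition j x * 2^-1 + 8^-1 * 2^-1 ^+ j) * `|x - y|.
    have [_ lc ll] := Hl j; have [_ pM] := HM j.
    have px := partition_ge0 j x; have py := partition_ge0 j y.
    have E1 : `|partition j x - partition j y| * eps j <= 8^-1 * 2^-1 ^+ j * `|x - y|.
      apply: le_trans (ler_wpM2r (ltW (eps0 j)) (pM x y)) _.
      by rewrite mulrAC ler_wpM2r.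
    have F0 : 0 <= partition j x * 2^-1 * `|x - y|.
      by apply: mulr_ge0 => //; apply: mulr_ge0 => //; rewrite invr_ge0.
    have pz z : h j z = 0 -> partition j z = 0 by move=> hz; rewrite /partition hz mulr0.
    have E0 : 0 <= 8^-1 * 2^-1 ^+ j * `|x - y|.
      by apply: mulr_ge0 => //; apply: mulr_ge0 => //; exact: ltW.
    rewrite mulrDl; have [hx0|hx0] := eqVneq (h j x) 0.
      rewrite (pz _ hx0) !mul0r sub0r add0r normrN.
      have [hy0|hy0] := eqVneq (h j y) 0; first by rewrite (pz _ hy0) mul0r normr0.
      apply: le_trans E1; rewrite (pz _ hx0) sub0r normrN normrM.
      by rewrite ler_wpM2l//; exact: lc.
    have [hy0|hy0] := eqVneq (h j y) 0.
      rewrite (pz _ hy0) mul0r subr0 -[leLHS]add0r lerD//.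
      apply: le_trans E1; rewrite (pz _ hy0) subr0 normrM.
      by rewrite ler_wpM2l//; exact: lc.
    have -> : partition j x * v j x - partition j y * v j y =
      partition j x * (v j x - v j y) + (partition j x - partition j y) * v j y by ring.
    apply: le_trans (ler_normD _ _) _.
    rewrite (normrM (partition j x)) (normrM (_ - _)); apply: lerD.
      by rewrite (ger0_norm px) -mulrA ler_wpM2l//; exact: ll.
    by apply: le_trans E1; rewrite ler_wpM2l//; exact: lc.
  apply: le_trans (ler_sum _ (fun (j : 'I_N) _ => term j)) _.
  rewrite -mulr_suml ler_piMl// big_split/= -mulr_suml -mulr_sumr partition_sum.
  have /andP[r0 r1] := remainder_itv N x.
  have : \sum_(j < N) (2^-1 ^+ j : R) <= 2.
    suff : \sum_(j < N) (2^-1 ^+ j : R) = 2 * (1 - 2^-1 ^+ N).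
      by move=> ->; have := hp N; lra.
    elim: (N) => [|k IH]; first by rewrite big_ord0 subrr mulr0.
    by rewrite big_ord_recr/= IH exprS; field.
  lra.
- move=> x; have hx := nbhs_singleton (HI0 x).
  rewrite (diffE _ _ _ hx (ltnSn _)).
  apply: le_trans (ler_norm_sum _ _ _) _.
  apply: (@le_trans _ _ (\sum_(j < (I0 x).+1) partition j x * 8^-1)).
    apply: ler_sum => j _; rewrite (normrM (partition j x)) (ger0_norm (partition_ge0 _ _)).
    have [p0|/partition_neq0 hn0] := eqVneq (partition j x) 0; first by rewrite p0 !mul0r.
    by rewrite ler_wpM2l//; have [_ lc _] := Hl j; exact: le_trans (lc x hn0) (eps8 j).
  rewrite -mulr_suml partition_sum (remainder0 hx (ltnSn _)) subr0 mul1r//.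
- move=> n sn.
  have cr j : Ck n (remainder j).
    elim: j => [|j IH]; first exact: Ck_cst.
    by apply: (CkM IH); apply: CkB; [exact: Ck_cst|exact: h_Ck].
  apply: Ck_local => x; exists (gN (I0 x).+1).
    apply: (@Ck_sum _ n _ _ (I0 x).+1 (fun j x => partition j x * l j x : R^o)) => j _.
    apply: CkM; last by have [cl _ _] := Hl j; exact: cl.
    by apply: CkM => //; exact: h_Ck.
  apply: filterS (HI0 x) => y hy; exact: gE hy (ltnSn _).
Qed.

End Glue.

Section FineApproximation.
Variables (R : realType) (X : completeNormedModType R) (e : nat -> X).
Variables (a : nat -> clin X R^o) (C : R).
Hypothesis C1 : 1 <= C.
Hypothesis a_cvg : forall x, series (fun n => a n x *: e n) @ \oo --> x.
Hypothesis a_basis : forall i j, a i (e j) = (i == j)%:R.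
Hypothesis a_mult : forall x (t : nat -> R), (forall n, `|t n| <= 1) -> forall N,
  `|\sum_(0 <= n < N) (t n * a n x) *: e n| <= C * `|x|.

(** Finite combinations of the basis with rational coefficients are dense. *)
Lemma basis_separable : exists D : nat -> X,
  forall x (eps : R), 0 < eps -> exists k, `|x - D k| < eps.
Proof.
pose P (s : seq rat) : X := \sum_(i < size s) ratr (nth 0 s i) *: e i.
exists (fun k => if unpickle k is Some s then P s else 0) => x eps eps0.
have e2 : 0 < eps / 2 by rewrite divr_gt0.
have [n _ Hn] : \forall n \near \oo, `|x - head e a n x| < eps / 2.
  by have /cvgrPdist_lt/(_ _ e2) := @head_cvg _ _ e a a_cvg x.
have {}Hn := Hn n (leqnn n).
have n0 : 0 < n.+1%:R :> R by rewrite ltr0n.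
have E0 i : 0 < 1 + `|e i| by rewrite ltr_pwDl.
have [q Hq] : exists q : nat -> rat, forall i,
    `|a i x - ratr (q i)| * `|e i| <= eps / 2 / n.+1%:R.
  suff H (i : nat) : exists q : rat, `|a i x - ratr q| * `|e i| <= eps / 2 / n.+1%:R.
    by have [q Hq] := choice H; exists q.
  pose del := eps / 2 / n.+1%:R / (1 + `|e i|).
  have del0 : 0 < del by rewrite /del !divr_gt0.
  have [q] := @rat_in_itvoo R (a i x - del) (a i x + del) ltac:(lra).
  rewrite in_itv/= => /andP[q1 q2]; exists q.
  apply: (@le_trans _ _ (del * (1 + `|e i|))); last by rewrite /del divfK// gt_eqF.
  rewrite ler_pM//; last by rewrite lerDr.
  by rewrite ler_norml; lra.
exists (pickle (mkseq q n)); rewrite pickleK /P size_mkseq.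
have -> : x - \sum_(i < n) ratr (nth 0 (mkseq q n) i) *: e i =
  (x - head e a n x) + \sum_(i < n) (a i x - ratr (q i)) *: e i.
  have -> : \sum_(i < n) (a i x - ratr (q i)) *: e i =
    head e a n x - \sum_(i < n) ratr (nth 0 (mkseq q n) i) *: e i.
    by rewrite -sumrB; apply: eq_bigr => i _; rewrite nth_mkseq// scalerBl.
  by linear_identity R.
apply: le_lt_trans (ler_normD _ _) _; rewrite [ltRHS]splitr ltr_leD//.
apply: le_trans (ler_norm_sum _ _ _) _.
apply: (@le_trans _ _ (\sum_(i < n) eps / 2 / n.+1%:R)).
  by apply: ler_sum => i _; rewrite normrZ.
rewrite sumr_const card_ord -[_ *+ n]mulr_natl mulrCA ler_piMr ?(ltW e2)//.
by rewrite ler_pdivrMr// mul1r ler_nat.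
Qed.

(** A function of class [C^1] differs by little from an affine map on small balls.
    On such a ball the difference has a small Lipschitz constant, and remains with
    a small one when it is approximated, however large the loss is. *)
Lemma C1_fine_approximation (L' : R) (psi f : X -> R^o) :
  0 <= L' -> cutoff L' psi -> Ck 1 f ->
  exists g : X -> R^o, [/\ Lip 1 (fun x => g x - f x : R^o),
    forall x, `|g x - f x| <= 8^-1 & forall n, Ck n psi -> Ck n g].
Proof.
move=> L'0 cpsi cf; have [D HD] := basis_separable.
pose C' := C * (1 + L' * (1 + C)).
have C'0 : 0 <= C' by rewrite /C'; have := C1; nra.
(* An approximation may multiply the constant [kap] by [C'], see [kapE]. *)
pose kap := 2^-1 / (C' + 1).
have C'1 : 0 < C' + 1 by rewrite ltr_wpDl.
have kap0 : 0 < kap by rewrite divr_gt0.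
have kapE : C' * kap + kap = 2^-1 by rewrite /kap; field; rewrite gt_eqF.
(* The candidate balls: center in the dense sequence, radius a power of 1/2. *)
pose pr (j : nat) : nat * nat := if unpickle j is Some p then p else (0, 0)%N.
pose c j := D (pr j).1; pose rho j : R := 2^-1 ^+ (pr j).2.
have rho0 j : 0 < rho j by rewrite exprn_gt0// invr_gt0.
pose good j := exists T : clin X R^o, forall y z, `|c j - y| < rho j -> `|c j - z| < rho j ->
    `|(f y - T y) - (f z - T z)| <= kap * `|y - z|.
pose h j x : R^o := if `[< good j >] then psi ((rho j)^-1 *: (x - c j)) else 0.
have h_in j x : h j x != 0 -> good j /\ `|c j - x| < rho j.
  rewrite /h; case: asboolP => [gj hx|_]; last by rewrite eqxx.
  split=> //; rewrite ltNge; apply: contra hx => rx; apply/eqP.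
  apply: (cutoff_zero cpsi); rewrite normrZ gtr0_norm ?invr_gt0//.
  by rewrite ler_pdivlMl// mulr1 distrC.
apply: (@glue _ _ f h (fun n => Ck n psi)).
- move=> j x; rewrite /h; case: ifP => _; last by rewrite lexx ler01.
  exact: (cutoff_itv cpsi).
- move=> j; exists (L' * (rho j)^-1); first by rewrite mulr_ge0// invr_ge0 ltW.
  move=> x y; rewrite /h; case: ifP => _.
    apply: le_trans (cutoff_Lip cpsi _ _) _; rewrite -mulrA ler_wpM2l//.
    rewrite -scalerBr normrZ gtr0_norm ?invr_gt0//.
    by rewrite (_ : x - c j - (y - c j) = x - y)//; linear_identity R.
  rewrite subrr normr0 !mulr_ge0// invr_ge0 ltW//.
- move=> j n cn; rewrite /h; case: asboolP => _; last exact: Ck_cst.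
  apply: (Ck_comp cn); apply: CkZ; first exact: Ck_cst.
  by apply: CkB; [exact: Ck_id|exact: Ck_cst].
- move=> x; have [s s0 [T HT]] := C1_locally_affine x kap0 cf.
  have [m /(_ m (leqnn m)) hm] := half_pow_lt 2 s0.
  have [del del0 Hdel] := cutoff_one cpsi.
  have r0 : 0 < 2^-1 ^+ m :> R by rewrite exprn_gt0// invr_gt0.
  have dr0 : 0 < del * 2^-1 ^+ m / 2 by rewrite divr_gt0// mulr_gt0.
  have min0 : 0 < Num.min (2^-1 ^+ m) (del * 2^-1 ^+ m / 2) by rewrite lt_min r0.
  have [k] := HD x _ min0; rewrite lt_min => /andP[k1 k2].
  pose j := pickle (k, m); exists j.
  have prj : pr j = (k, m) by rewrite /pr pickleK.
  have cj : c j = D k by rewrite /c prj.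
  have rj : rho j = 2^-1 ^+ m by rewrite /rho prj.
  have gj : good j.
    exists T => y z; rewrite cj rj => hy hz.
    by apply: HT; apply: le_lt_trans (ler_distD (D k) _ _) _; lra.
  apply/nbhs_normP; exists (del * 2^-1 ^+ m / 2) => // y /= xy.
  rewrite /h asboolT//; apply: Hdel; rewrite cj rj normrZ gtr0_norm ?invr_gt0//.
  rewrite ler_pdivrMl// mulrC; apply: le_trans (ler_distD x _ _) _.
  by move: xy; rewrite distrC; lra.
- move=> j eps eps0; have [[T HT]|ngj] := pselect (good j); last first.
    exists (fun=> 0); split; first by move=> n _; exact: Ck_cst.
      by move=> x /h_in[].
    by move=> x y /h_in[].
  pose B := [set y | `|c j - y| < rho j].
  have [|F FL FE] := @lipschitz_extension _ _ B (fun y => f y - T y) kap (ltW kap0).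
    by move=> y z; exact: HT.
  have [K [cK KL KF]] := Lip_approximation C1 a_cvg a_basis a_mult cpsi (ltW kap0) FL eps0.
  exists (fun x => T x + K x); split.
  + by move=> n cn; apply: CkD; [exact: Ck_clin|exact: cK].
  + move=> x /h_in[_ xB]; have := KF x; rewrite (FE x xB) => /ltW.
    by rewrite distrC (_ : T x + K x - f x = K x - (f x - T x))//; ring.
  + move=> x y /h_in[_ xB] /h_in[_ yB].
    have -> : T x + K x - f x - (T y + K y - f y) = (K x - K y) - (F x - F y).
      by rewrite (FE x xB) (FE y yB); ring.
    by apply: le_trans (ler_normB _ _) _; rewrite -kapE mulrDl lerD.
Qed.

(** A close approximation of [phi] as smooth as [psi], followed by a smooth step that
    restores the values 0 and 1, only costs the slope of the step and an additive
    term: the Lipschitz constant of [psi] does not enter. *)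
Lemma uniform_cutoff (L L' : R) (phi psi : X -> R^o) :
  cutoff L phi -> Ck 1 phi -> 0 <= L' -> cutoff L' psi ->
  exists chi : X -> R^o, cutoff (4 * (L + 1)) chi /\ forall n, Ck n psi -> Ck n chi.
Proof.
move=> cphi ck1 L'0 cpsi.
have [g [gL gphi gC]] := C1_fine_approximation L'0 cpsi ck1.
have [theta [ck_theta theta_Lip theta01 theta0 theta1]] := smooth_step_exists R.
have gphi' x : - 8^-1 <= g x - phi x <= 8^-1 by rewrite -ler_norml.
exists (theta \o g); split; last first.
  by move=> n cn; apply: (Ck_comp (ck_theta n)); exact: gC.
split.
- move=> x y; apply: le_trans (theta_Lip _ _) _; rewrite -mulrA ler_wpM2l//.
  have -> : g x - g y = (phi x - phi y) + ((g x - phi x) - (g y - phi y)) by ring.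
  apply: le_trans (ler_normD _ _) _; rewrite mulrDl.
  by apply: lerD; [exact: cutoff_Lip cphi x y|exact: gL x y].
- by move=> x; exact: theta01.
- have [del del0 Hdel] := cutoff_one cphi; exists del => // x /Hdel px.
  by apply: theta1; have := gphi' x; rewrite px; lra.
- move=> x /(cutoff_zero cphi) px.
  by apply: theta0; have := gphi' x; rewrite px; lra.
Qed.

End FineApproximation.

(** * The approximation theorem *)

Section Approximation.
Variables (R : realType) (X : normedModType R).

Lemma klipschitzP (Z : normedModType R) (k : R) (Y : set X) (f : X -> Z) :
  k.-lipschitz_Y f <-> forall x y, Y x -> Y y -> `|f x - f y| <= k * `|x - y|.
Proof.
split=> [H x y Yx Yy|H [x y] [/= Yx Yy]]; last exact: H.
exact: (H (x, y) (conj Yx Yy)).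
Qed.

Lemma Lip_lipschitz (Z : normedModType R) (k : R) (f : X -> Z) :
  Lip k f -> lipschitz f.
Proof.
move=> fk; exists k; split; first exact: num_real.
move=> M kM [x y] _ /=; apply: le_trans (fk x y) _.
by rewrite ler_wpM2r// ltW.
Qed.

(** On a convex set the modulus of continuity grows at most linearly, since a long
    segment is cut into short ones. *)
Lemma convex_unif_continuous (Y : set X) (f : X -> R^o) (eps : R) :
  convex_set Y -> unif_continuous (f : subspace Y -> R^o) -> 0 < eps ->
  exists2 A : R, 0 <= A &
    forall x y, Y x -> Y y -> `|f x - f y| <= eps + A * `|x - y|.
Proof.
move=> cY /unif_continuousP ucf eps0; have [d /= d0 Hd] := ucf eps eps0.
have {}Hd x y : Y x -> Y y -> `|x - y| < d -> `|f x - f y| < eps.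
  move=> Yx Yy xy; have /(Hd (x, y)) : ball (x : subspace Y) d y.
    by rewrite ball_subspace_ball /subspace_ball mem_set//; split=> //=; rewrite -ball_normE.
  by rewrite /= -ball_normE.
exists (eps / d) => [|x y Yx Yy]; first by rewrite divr_ge0// ltW.
pose n := (Num.truncn (`|x - y| / d)).+1.
have xyd0 : 0 <= `|x - y| / d by rewrite divr_ge0// ltW.
have n0 : 0 < n%:R :> R by rewrite ltr0n.
have n1 : `|x - y| < n%:R * d by rewrite -ltr_pdivrMr// truncnS_gt.
have n2 : n%:R <= `|x - y| / d + 1 by rewrite -natr1 lerD2r truncn_le.
pose z (i : nat) := x + (i%:R / n%:R) *: (y - x).
have Yz i : (i <= n)%N -> Y (z i).
  move=> ni; have t0 : 0 <= i%:R / n%:R :> R by rewrite divr_ge0// ltW.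
  have t1 : i%:R / n%:R <= 1 :> R by rewrite ler_pdivrMr// mul1r ler_nat.
  have := cY y x (Itv01 t0 t1) (mem_set Yy) (mem_set Yx).
  rewrite inE; congr Y; rewrite /conv/= /z /unstable.onem.
  by set t := i%:R / n%:R; linear_identity R.
have step i : (i < n)%N -> `|f (z i.+1) - f (z i)| <= eps.
  move=> ni; apply/ltW/Hd; [exact: Yz|exact/Yz/ltnW|].
  have -> : z i.+1 - z i = n%:R^-1 *: (y - x).
    by rewrite /z -natr1; linear_identity R; rewrite gt_eqF.
  by rewrite normrZ gtr0_norm ?invr_gt0// distrC ltr_pdivrMl.
have tele i : (i <= n)%N -> `|f (z i) - f (z 0%N)| <= i%:R * eps.
  elim: i => [|i IH] ni; first by rewrite subrr normr0 mul0r.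
  rewrite -(subrK (f (z i)) (f (z i.+1))) -addrA; apply: le_trans (ler_normD _ _) _.
  rewrite -natr1 mulrDl mul1r [leRHS]addrC.
  by apply: lerD; [exact: step|apply: IH; exact: ltnW].
have := tele n (leqnn n).
have -> : z n = y by rewrite /z divff ?gt_eqF// scale1r addrC subrK.
have -> : z 0%N = x by rewrite /z mul0r scale0r addr0.
rewrite distrC => /le_trans; apply.
apply: le_trans (ler_wpM2r (ltW eps0) n2) _.
by rewrite mulrDl mul1r addrC lerD2l le_eqVlt; apply/orP; left; apply/eqP; field; rewrite gt_eqF.
Qed.

End Approximation.

Theorem theorem1 (R : realType) (X : completeNormedModType R)
    (hX : exists e : nat -> X, unconditional_basis e) :
  (forall p : option nat, p != Some 0%N -> has_lipschitz_bump p X ->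
    forall (Y : set X) (f : X -> R^o),
      convex_set Y -> unif_continuous (f : subspace Y -> R^o) ->
    forall eps : R, 0 < eps ->
    exists K : X -> R^o,
      [/\ lipschitz K, Cp_smooth p K & forall y, Y y -> `|f y - K y| < eps])
  /\
  (exists2 C0 : R, 1 < C0 &
    forall p : option nat, p != Some 0%N -> has_lipschitz_bump p X ->
    (forall (Z : completeNormedModType R) (eta : R) (f : X -> Z),
       0 <= eta -> eta.-lipschitz f ->
     forall eps : R, 0 < eps ->
     exists K : X -> Z,
       [/\ Cp_smooth p K, (C0 * eta).-lipschitz K &
           forall x, `|f x - K x| < eps])
    /\
    (forall (Y : set X) (eta : R) (f : X -> R^o),
       0 <= eta -> eta.-lipschitz_Y f ->
     forall eps : R, 0 < eps ->
     exists K : X -> R^o,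
       [/\ Cp_smooth p K, (C0 * eta).-lipschitz K &
           forall y, Y y -> `|f y - K y| < eps])).
Proof.
have [e /unconditional_coordinates[a [C [C1 a_cvg a_basis a_mult]]]] := hX.
have [C0 C0_gt1 approx] : exists2 C0 : R, 1 < C0 &
    forall p, p != Some 0%N -> has_lipschitz_bump p X ->
    forall (Z : completeNormedModType R) (eta : R) (f : X -> Z),
      0 <= eta -> Lip eta f -> forall eps : R, 0 < eps ->
    exists K : X -> Z, [/\ Cp_smooth p K, Lip (C0 * eta) K & forall x, `|f x - K x| < eps].
  have [[p1 [p10 bp1]]|nobump] :=
      pselect (exists p, p != Some 0%N /\ has_lipschitz_bump p X); last first.
    exists 2; first by rewrite ltr1n.
    by move=> p p0 bp; case: nobump; exists p.
  (* [p1] is any order of smoothness that has a bump; the constant only uses the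
     Lipschitz constant [L] of the cutoff obtained from it. *)
  have [L [phi [L0 cphi /(Cp_smooth_C1 p10) ck1]]] := bump_cutoff bp1.
  pose C' := C * (1 + 4 * (L + 1) * (1 + C)).
  have C'0 : 0 <= C' by rewrite /C'; have := C1; nra.
  exists (C' + 2); first by lra.
  move=> p p0 /bump_cutoff[L' [psi [L'0 cpsi psiC]]] Z eta f eta0 fL eps eps0.
  have [chi [cchi chiC]] := uniform_cutoff C1 a_cvg a_basis a_mult cphi ck1 L'0 cpsi.
  have [K [KC KL Kf]] := Lip_approximation C1 a_cvg a_basis a_mult cchi eta0 fL eps0.
  exists K; split=> //.
    by apply: (Cp_smooth_transfer _ psiC) => n /chiC; exact: KC.
  move=> x y; apply: le_trans (KL x y) _; rewrite ler_wpM2r// ler_wpM2r//.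
  by rewrite lerDl.
split.
- move=> p p0 bp Y f cY ucf eps eps0.
  have e3 : 0 < eps / 3 by rewrite divr_gt0.
  have [A A0 fA] := convex_unif_continuous cY ucf e3.
  have [F FA Ff] := inf_convolution A0 fA.
  have [K [KC KL KF]] := approx p p0 bp _ A F A0 FA (eps / 3) e3.
  exists K; split=> //; first exact: Lip_lipschitz KL.
  move=> y Yy; have := KF y; have := Ff y Yy; rewrite distrC => h1 h2.
  rewrite -(subrK (F y) (f y)) -addrA; apply: le_lt_trans (ler_normD _ _) _.
  lra.
- exists C0 => // p p0 bp; split.
  + move=> Z eta f eta0 /klipschitzP fL eps eps0.
    have [|K [KC KL Kf]] := approx p p0 bp Z eta f eta0 _ eps eps0.
      by move=> x y; exact: fL.
    by exists K; split=> //; apply/klipschitzP => x y _ _; exact: KL.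
  + move=> Y eta f eta0 /klipschitzP fL eps eps0.
    have [F FL Ff] := lipschitz_extension eta0 fL.
    have [K [KC KL KF]] := approx p p0 bp _ eta F eta0 FL eps eps0.
    exists K; split=> //; first by apply/klipschitzP => x y _ _; exact: KL.
    by move=> y Yy; rewrite -Ff.
Qed.
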